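(* Let $\mathbb{K}$ be an algebraically closed field of characteristic zero, let $k\geq 3$, and let $\lambda_2,\dots,\lambda_k\in\mathbb{K}\setminus\{0\}$ be pairwise distinct. Every trinomial variety $X$ (in the variables $T_{ij}$, $0\le i\le k$, $1\le j\le n_i$) of one of the following three types is flexible: Type $V_1$: $X$ is the common zero set of the polynomials $$\lambda_iT_0^{l_0}+T_1^{l_1}-T_{i1}T_{i2}\cdots T_{in_i},\qquad 2\le i\le k;$$ Type $V_3$: $n_0\ge 1$ and $X$ is the common zero set of the polynomials $$\lambda_iT_{01}\widehat T_0^{l_0}+T_1^{l_1}-T_{i1}\widehat T_i^{l_i},\qquad 2\le i\le k;$$ Type $V_4$: $n_0\ge 1$ and $X$ is the common zero set of the polynomials $$\lambda_iT_{01}^2\widehat T_0^{2m_0}+T_{11}^2\widehat T_1^{2m_1}-T_{i1}\widehat T_i^{l_i},\qquad 2\le i\le k.$$ Here all exponents $l_{ij}$ and $m_{ij}$ are arbitrary positive integers.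
   Context: Let $n_0\ge 0$ and $n_1,\dots,n_k\ge 1$ be integers, and let $T_{ij}$ ($0\le i\le k$, $1\le j\le n_i$) be coordinates on the affine space of dimension $n_0+n_1+\dots+n_k$ over $\mathbb{K}$. For a tuple of positive integers $l_i=(l_{i1},\dots,l_{in_i})$ put $T_i^{l_i}=T_{i1}^{l_{i1}}\cdots T_{in_i}^{l_{in_i}}$; if $n_0=0$, then $l_0$ is the empty tuple and $T_0^{l_0}=1$. A trinomial variety is the affine subvariety of this affine space given by a system $\lambda_iT_0^{l_0}+T_1^{l_1}-T_i^{l_i}=0$, $2\le i\le k$, with pairwise distinct nonzero $\lambda_i\in\mathbb{K}$; it is known to be irreducible and normal. There are no variables other than the $T_{ij}$. Notation: $\widehat T_i^{l_i}=T_{i2}^{l_{i2}}T_{i3}^{l_{i3}}\cdots T_{in_i}^{l_{in_i}}$ and $\widehat T_i^{2m_i}=T_{i2}^{2m_{i2}}T_{i3}^{2m_{i3}}\cdots T_{in_i}^{2m_{in_i}}$ (each is an empty product, equal to $1$, if $n_i=1$). Let $\mathbb{G}_a$ be the additive group of $\mathbb{K}$. A $\mathbb{G}_a$-action on an affine variety $X$ is a regular action of the algebraic group $\mathbb{G}_a$ on $X$. An irreducible affine variety $X$ is called flexible if for every regular (smooth) point $x\in X$ the tangent space $T_xX$ is spanned by the tangent vectors at $x$ to the orbits of $x$ under various $\mathbb{G}_a$-actions on $X$. (If $\dim X\ge 2$, this is equivalent to transitivity on the regular locus of $X$ of the group $\mathrm{SAut}(X)$ generated by the images in $\mathrm{Aut}(X)$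 of all $\mathbb{G}_a$-actions.) *)

(* Defs.v *)
From HB Require Import structures.
From mathcomp Require Import all_boot all_order all_algebra.
From mathcomp Require Import mpoly.

Set Implicit Arguments.
Unset Strict Implicit.
Unset Printing Implicit Defensive.

Import GRing.Theory.
Local Open Scope ring_scope.

Section AffineGeometry.

Variables (K : closedFieldType) (N : nat).

Notation point := 'rV[K]_N.
Notation pset := (point -> Prop).

Implicit Types (X Y Z : pset) (x v : point) (f : {mpoly K[N]}).

Definition subvar X Y : Prop := forall x, X x -> Y x.

Definition zclosed X : Prop :=
  exists S : {mpoly K[N]} -> Prop,
    forall x, X x <-> (forall f, S f -> f.@[x 0] = 0).

Definition irreducible X : Prop :=
  (exists x, X x) /\
  forall Y Z, zclosed Y -> zclosed Z ->
    (forall x, X x -> Y x \/ Z x) -> subvar X Y \/ subvar X Z.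

Definition irreducible_affine_variety X : Prop := zclosed X /\ irreducible X.

(* C 0 < C 1 < ... < C d (strict inclusions); the values C i for i > d are irrelevant. *)
Definition irr_chain X (d : nat) (C : nat -> pset) : Prop :=
  (forall i, (i <= d)%N ->
     irreducible_affine_variety (C i) /\ subvar (C i) X) /\
  (forall i, (i < d)%N ->
     subvar (C i) (C i.+1) /\ ~ subvar (C i.+1) (C i)).

Definition krull_dim X (d : nat) : Prop :=
  (exists C, irr_chain X d C) /\
  (forall d' C, irr_chain X d' C -> (d' <= d)%N).

(* The full vanishing ideal of X is used, not just a set of equations. *)
Definition tangent X x v : Prop :=
  forall f, (forall y, X y -> f.@[y 0] = 0) ->
    \sum_(i < N) (f^`M(i)).@[x 0] * v 0 i = 0.

(* Meant for irreducible X, whose local dimension at every point is dim X. *)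
Definition regular_point X x : Prop :=
  X x /\
  exists (d : nat) (U : {vspace point}),
    [/\ krull_dim X d, forall v, v \in U <-> tangent X x v & \dim U = d].

(* A morphism G_a x X -> X is the restriction of a polynomial map
   A^1 x A^N -> A^N, given by N elements of K[x_1, .., x_N][s]. *)
Definition Ga_map : Type := 'rV[{poly {mpoly K[N]}}]_N.

Definition Ga_act (P : Ga_map) (s : K) x : point :=
  \row_i ((P 0 i).[s%:MP]).@[x 0].

Definition Ga_action X (P : Ga_map) : Prop :=
  [/\ forall s x, X x -> X (Ga_act P s x),
      forall x, X x -> Ga_act P 0 x = x
    & forall s t x, X x -> Ga_act P (s + t) x = Ga_act P s (Ga_act P t x)].

(* The derivative at s = 0 of s |-> Ga_act P s x. *)
Definition orbit_tangent x (P : Ga_map) : point :=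
  \row_i ((map_poly (meval (x 0)) (P 0 i))^`()).[0].

Definition flexible X : Prop :=
  irreducible_affine_variety X /\
  forall x, regular_point X x ->
    forall v, tangent X x v <->
      exists s : seq Ga_map,
        (forall P, P \in s -> Ga_action X P) /\
        v \in <<[seq orbit_tangent x P | P <- s]>>%VS.

End AffineGeometry.

Section Trinomial.

Variables (K : closedFieldType) (k : nat) (n : 'I_k.+1 -> nat).

(* The variable T_ij (j >= 1) is indexed by i and the ordinal j - 1; in
   particular T_i1 corresponds to the ordinal 0 of 'I_(n i). *)
Definition tri_nvars : nat := #|{: {i : 'I_k.+1 & 'I_(n i)}}|.

Definition tri_index (i : 'I_k.+1) (j : 'I_(n i)) : 'I_tri_nvars :=
  enum_rank (Tagged (fun i => 'I_(n i)) j).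

Definition tri_monomial (l : forall i, 'I_(n i) -> nat) (i : 'I_k.+1) :
    {mpoly K[tri_nvars]} :=
  \prod_(j < n i) 'X_(tri_index j) ^+ l i j.

(* [inord 1] is the index 1 as soon as k >= 1. *)
Definition trinomial (lambda : 'I_k.+1 -> K) (l : forall i, 'I_(n i) -> nat)
    (i : 'I_k.+1) : {mpoly K[tri_nvars]} :=
  lambda i *: tri_monomial l ord0 + tri_monomial l (inord 1)
  - tri_monomial l i.

Definition trinomial_variety (lambda : 'I_k.+1 -> K)
    (l : forall i, 'I_(n i) -> nat) (x : 'rV[K]_tri_nvars) : Prop :=
  forall i : 'I_k.+1, (2 <= i)%N -> (trinomial lambda l i).@[x 0] = 0.

Definition type_V1 (l : forall i, 'I_(n i) -> nat) : Prop :=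
  forall (i : 'I_k.+1) (j : 'I_(n i)), (2 <= i)%N -> l i j = 1%N.

Definition type_V3 (l : forall i, 'I_(n i) -> nat) : Prop :=
  (1 <= n ord0)%N /\
  forall (i : 'I_k.+1) (j : 'I_(n i)),
    i != 1%N :> nat -> j = 0%N :> nat -> l i j = 1%N.

Definition type_V4 (l : forall i, 'I_(n i) -> nat) : Prop :=
  [/\ (1 <= n ord0)%N,
      forall (i : 'I_k.+1) (j : 'I_(n i)),
        (i <= 1)%N -> j = 0%N :> nat -> l i j = 2%N,
      forall (i : 'I_k.+1) (j : 'I_(n i)), (i <= 1)%N -> (2 %| l i j)%N
    & forall (i : 'I_k.+1) (j : 'I_(n i)),
        (2 <= i)%N -> j = 0%N :> nat -> l i j = 1%N].

End Trinomial.

(* Main.v *)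
Require Import Defs.
From HB Require Import structures.
From mathcomp Require Import all_boot all_order all_algebra.
From mathcomp Require Import mpoly.
From mathcomp Require Import ring.
From Stdlib Require Import Classical FunctionalExtensionality PropExtensionality.

Set Implicit Arguments.
Unset Strict Implicit.
Unset Printing Implicit Defensive.

Import GRing.Theory.
Local Open Scope ring_scope.

(** With t_i the monomial of block i and (al_0, ga_0) = (1, 0), (al_1, ga_1) = (0, 1),
(al_i, ga_i) = (lambda_i, 1) for i >= 2, the variety X is
{t_i = al_i t_0 + ga_i t_1 for all i}, where any two t_i determine all the others.

A vector be = A al + B ga with be_{i0} = 0 and a choice of a variable T_{a_k} in each
block k <> i0, of exponent 1 for all k <> i0 except at most one, define a locally
nilpotent derivation of K[X]: D T_{a_k} = be_k prod_{k' <> k, i0} dt_k'/dT_{a_k'}, all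
other variables being killed.  For type V4 one also factors
t_i = al_i t_0 + ga_i t_1 = y z with y, z linear in the square roots of t_0 and t_1, and
uses the derivation that kills y.  These derivations have explicit exponentials.

At a point with nonzero coordinates their values span the tangent space.  Let x have a
zero coordinate.  If some t_k(x) <> 0, or if all but two blocks have at x a single zero
coordinate, of exponent 1, then some action moves a zero coordinate of x away from zero;
by induction on the number of zeros, x is joined by actions to a point with nonzero
coordinates, and conjugation transports the tangent vectors back to x.

At the remaining points the tangent space has dimension > dim X, so they are singular:
every coordinate vector is tangent, except those of single zeros of exponent 1.  Here
one needs that X is irreducible: the open set where the T_ij with i >= 2, j >= 2 do not
vanish is a graph over an open subset of an affine space, and it is dense.  The same
graph bounds the Krull dimension, because a chain of d + 1 irreducible closed sets
yields d algebraically independent functions on X, whereas counting monomials shows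
that more than m rational functions in m variables are algebraically dependent. *)

(** * Polynomial curves and transport of tangent vectors *)

Lemma closed_root (K : closedFieldType) n (b : K) : (0 < n)%N -> exists r, r ^+ n = b.
Proof.
case: n => // n _; have [r rE] := @solve_monicpoly K n.+1 (nth 0 [:: b]) isT.
exists r; rewrite rE big_ord_recl /= expr0 mulr1 big1 ?addr0 // => i _.
by rewrite nth_nil mul0r.
Qed.

Lemma mpoly_ring_ind (n : nat) (R : comNzRingType) (P : {mpoly R[n]} -> Prop) :
  (forall c, P c%:MP) -> (forall i, P 'X_i) ->
  (forall p q, P p -> P q -> P (p + q)) ->
  (forall p q, P p -> P q -> P (p * q)) -> forall p, P p.
Proof.
move=> PC PX PD PM; elim/mpolyind => [|c m p _ _ Pp]; first exact: PC.
apply: (PD _ _ _ Pp); rewrite -mul_mpolyC; apply: (PM); [exact: PC | rewrite mpolyXE_id].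
apply: (big_ind P) => [||i _]; [exact: PC | exact: PM |].
by elim: (m i) => [|e IH]; rewrite ?expr0 ?exprS; [exact: PC | exact: (PM)].
Qed.

Lemma mderivXU (n : nat) (R : nzRingType) (i j : 'I_n) :
  ('X_i)^`M(j) = (i == j)%:R :> {mpoly R[n]}.
Proof.
rewrite mderivX mnm1E; case: eqVneq => [->|_]; last by rewrite scale0r.
by rewrite scale1r -{1}[U_(j)%MM]add0m addmK mpolyX0.
Qed.

Section Curves.

Variables (K : closedFieldType) (N : nat).
Implicit Types (f : {mpoly K[N]}) (x v : 'rV[K]_N) (c : 'I_N -> {poly K}).

Lemma poly_nonroot (p : {poly K}) : p != 0 -> exists s, p.[s] != 0.
Proof.
move=> p0; have size_Xp : (1 < size ('X * p)%R)%N.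
  by rewrite mulrC size_mulX // ltnS size_poly_gt0.
(* At a root of ['X * p - 1] the value of [p] is nonzero. The factor ['X] makes this polynomial
   nonconstant even when [p] is a constant. *)
have /closed_rootP[s] : size ('X * p - 1) != 1%N.
  by rewrite size_polyDl ?size_polyN ?size_poly1 // neq_ltn size_Xp orbT.
rewrite rootE !hornerE subr_eq0 => /eqP sp; exists s.
by apply: contra_eq_neq sp => ->; rewrite mulr0 eq_sym oner_eq0.
Qed.

Lemma poly_ext (p q : {poly K}) : (forall s, p.[s] = q.[s]) -> p = q.
Proof.
move=> pq; apply/eqP; rewrite -subr_eq0; apply/negP => /negP/poly_nonroot[s].
by rewrite !hornerE pq subrr eqxx.
Qed.

Definition mcurve c f : {poly K} := mmap (@polyC K) c f.

Lemma horner_mcurve c f s : (mcurve c f).[s] = f.@[fun i => (c i).[s]].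
Proof.
elim/mpoly_ring_ind: f => [a|i|p q IHp IHq|p q IHp IHq].
- by rewrite /mcurve mmapC mevalC hornerC.
- by rewrite /mcurve mmapX mmap1U mevalXU.
- by rewrite /mcurve mmapD hornerD IHp IHq mevalD.
- by rewrite /mcurve rmorphM hornerM IHp IHq mevalM.
Qed.

Lemma deriv_mcurve c f s :
  (mcurve c f)^`().[s] =
  \sum_i f^`M(i).@[fun j => (c j).[s]] * (c i)^`().[s].
Proof.
elim/mpoly_ring_ind: f => [a|i|p q IHp IHq|p q IHp IHq].
- rewrite /mcurve mmapC derivC horner0 big1 // => i _.
  by rewrite mderivC meval0 mul0r.
- rewrite /mcurve mmapX mmap1U (bigD1 i) //= big1 => [|j ji].
    by rewrite mderivXU eqxx meval1 mul1r addr0.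
  by rewrite mderivXU eq_sym (negbTE ji) meval0 mul0r.
- rewrite /mcurve mmapD derivD hornerD IHp IHq -big_split /=.
  by apply: eq_bigr => i _; rewrite mderivD mevalD mulrDl.
- rewrite /mcurve rmorphM /= derivM hornerD !hornerM IHp IHq.
  rewrite !horner_mcurve mulr_suml mulr_sumr -big_split /=.
  apply: eq_bigr => i _; rewrite mderivM mevalD !mevalM mulrDl.
  by congr (_ + _); [rewrite -!mulrA; congr (_ * _); rewrite mulrC | rewrite mulrA].
Qed.

Lemma meval_comp (x : 'I_N -> K) (F : N.-tuple {mpoly K[N]}) f :
  (comp_mpoly F f).@[x] = f.@[fun i => (tnth F i).@[x]].
Proof.
elim/mpoly_ring_ind: f => [a|i|p q IHp IHq|p q IHp IHq].
- by rewrite comp_mpolyC !mevalC.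
- by rewrite comp_mpolyXU mevalXU -tnth_nth.
- by rewrite comp_mpolyD !mevalD IHp IHq.
- by rewrite rmorphM !mevalM IHp IHq.
Qed.

Definition at_time c s : 'rV[K]_N := \row_i (c i).[s].
Definition velocity c s : 'rV[K]_N := \row_i (c i)^`().[s].

(** A polynomial vanishing on [X] is identically zero along the curve, so the chain rule at time [s]
    yields the tangency equation. *)
Lemma tangent_velocity (X : 'rV[K]_N -> Prop) c :
  (forall s, X (at_time c s)) -> forall s, tangent X (at_time c s) (velocity c s).
Proof.
move=> Xc s f f0.
have /(congr1 (fun p => p^`().[s])) : mcurve c f = 0.
  apply: poly_ext => r; rewrite horner_mcurve horner0 -(f0 _ (Xc r)).
  by apply: meval_eq => i; rewrite mxE.
rewrite /= deriv_mcurve derivC horner0 => {2}<-; apply: eq_bigr => i _.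
by rewrite mxE; congr (_ * _); apply: meval_eq => j; rewrite mxE.
Qed.

(** Along the curve [f] becomes a polynomial in [s]; were it nonzero, its product with [h] would
    have a non-root. *)
Lemma curve_vanish f c (h : {poly K}) : h != 0 ->
  (forall s, h.[s] != 0 -> f.@[at_time c s 0] = 0) -> forall s, f.@[at_time c s 0] = 0.
Proof.
move=> h0 fh s; have fE r : f.@[at_time c r 0] = (mcurve c f).[r].
  by rewrite horner_mcurve; apply: meval_eq => i; rewrite mxE.
rewrite fE; have [->|f0] := eqVneq (mcurve c f) 0; first by rewrite horner0.
have [r] := poly_nonroot (mulf_neq0 f0 h0).
by rewrite hornerM mulf_eq0 negb_or => /andP[fr /fh]; rewrite fE => /eqP; rewrite (negbTE fr).
Qed.

Definition gcurve (P : Ga_map K N) x (i : 'I_N) : {poly K} :=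
  map_poly (meval (x 0)) (P 0 i).

Lemma horner_gcurve (P : Ga_map K N) x i s : (gcurve P x i).[s] = Ga_act P s x 0 i.
Proof. by rewrite mxE /gcurve -horner_map /= mevalC. Qed.

Lemma at_time_gcurve (P : Ga_map K N) x s : at_time (gcurve P x) s = Ga_act P s x.
Proof. by apply/rowP => i; rewrite mxE horner_gcurve. Qed.

Lemma velocity_gcurve (P : Ga_map K N) x :
  velocity (gcurve P x) 0 = orbit_tangent x P.
Proof. by apply/rowP => i; rewrite !mxE. Qed.

Lemma tangent_orbit (X : 'rV[K]_N -> Prop) P x :
  Ga_action X P -> X x -> tangent X x (orbit_tangent x P).
Proof.
case=> PX P0 _ Xx; rewrite -velocity_gcurve -{1}(P0 x Xx) -at_time_gcurve.
by apply: tangent_velocity => s; rewrite at_time_gcurve; apply: PX.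
Qed.

(** The conjugate [Q_r P_s Q_{-r}]. As a [Ga_map] is a polynomial formula, the composition is
    formal: the coefficients of [P] in [s] are composed with [Q_{-r}], and the results are
    substituted into [Q_r]. *)
Definition Ga_conj (Q : Ga_map K N) (r : K) (P : Ga_map K N) : Ga_map K N :=
  \row_i mmap (@polyC _ \o @mpolyC N K)
    (fun j => map_poly (comp_mpoly [tuple (Q 0 i).[(- r)%:MP] | i < N]) (P 0 j))
    (Q 0 i).[r%:MP].

Lemma Ga_act_conj Q r P s x :
  Ga_act (Ga_conj Q r P) s x = Ga_act Q r (Ga_act P s (Ga_act Q (- r) x)).
Proof.
apply/rowP => i; rewrite !mxE; move: (Q 0 i).[r%:MP] => f.
elim/mpoly_ring_ind: f => [a|j|p q IHp IHq|p q IHp IHq].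
- by rewrite mmapC /= hornerC !mevalC.
- rewrite mmapX mmap1U mevalXU mxE -[s%:MP in LHS](comp_mpolyC _ [tuple (Q 0 i).[(- r)%:MP] | i < N]).
  rewrite horner_map meval_comp; apply: meval_eq => k.
  by rewrite tnth_mktuple mxE.
- by rewrite mevalD -IHp -IHq rmorphD hornerD mevalD.
- by rewrite mevalM -IHp -IHq rmorphM hornerM mevalM.
Qed.

Lemma Ga_action_conj (X : 'rV[K]_N -> Prop) Q r P :
  Ga_action X Q -> Ga_action X P -> Ga_action X (Ga_conj Q r P).
Proof.
move=> [QX Q0 QD] [PX P0 PD].
have QK x : X x -> Ga_act Q r (Ga_act Q (- r) x) = x.
  by move=> Xx; rewrite -QD // subrr Q0.
have QNK x : X x -> Ga_act Q (- r) (Ga_act Q r x) = x.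
  by move=> Xx; rewrite -QD // addNr Q0.
split=> [s x Xx|x Xx|s t x Xx]; rewrite !Ga_act_conj.
- by apply/QX/PX/QX.
- by rewrite P0 ?QK //; apply: QX.
- by rewrite PD ?QNK //; [apply/PX/QX | apply: QX].
Qed.

Definition spanned (X : 'rV[K]_N -> Prop) x : Prop :=
  exists s : seq (Ga_map K N), (forall P, P \in s -> Ga_action X P) /\
    forall v, tangent X x v -> v \in <<[seq orbit_tangent x P | P <- s]>>%VS.

(** With [y = Q_r x], the differential of [Q_r] pushes a tangent vector [v] at [x] to a tangent
    vector [w] at [y]. There [w] is a combination of orbit tangents, and the Jacobian of [Q_{-r}]
    carries these to orbit tangents at [x] of conjugate actions. *)
Lemma spanned_Ga_act (X : 'rV[K]_N -> Prop) Q r x :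
  Ga_action X Q -> X x -> spanned X (Ga_act Q r x) -> spanned X x.
Proof.
move=> QA Xx [s [sA span_s]]; have [QX Q0 QD] := QA.
set y := Ga_act Q r x in span_s.
exists [seq Ga_conj Q (- r) P | P <- s]; split=> [_ /mapP[P sP ->]|v Tv].
  by apply: Ga_action_conj => //; apply: sA.
pose F := [tuple (Q 0 i).[r%:MP] | i < N].
(* The line through [x] in direction [v], not assumed to lie in [X], serves to write differentials
   as derivatives in one variable. *)
pose c i : {poly K} := (x 0 i)%:P + (v 0 i)%:P * 'X.
have c0 i : (c i).[0] = x 0 i by rewrite !hornerE ?mulr0 ?addr0.
have dc0 i : (c i)^`().[0] = v 0 i by rewrite !derivE !hornerE; ring.
have dline f : (mcurve c f)^`().[0] = \sum_i f^`M(i).@[x 0] * v 0 i.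
  rewrite deriv_mcurve; apply: eq_bigr => i _; rewrite dc0; congr (_ * _).
  by apply: meval_eq => j; rewrite c0.
pose d i := mcurve c (tnth F i).
have d0 i : (d i).[0] = y 0 i.
  rewrite horner_mcurve tnth_mktuple mxE; apply: meval_eq => j; exact: c0.
have md f : mcurve d f = mcurve c (comp_mpoly F f).
  by apply: poly_ext => t; rewrite !horner_mcurve meval_comp; apply: meval_eq => i; rewrite horner_mcurve.
pose w := velocity d 0.
have Tw : tangent X y w.
  move=> f f0; have Ff z : X z -> (comp_mpoly F f).@[z 0] = 0.
    move=> Xz; rewrite meval_comp -(f0 (Ga_act Q r z)); last exact: QX.
    by apply: meval_eq => i; rewrite tnth_mktuple mxE.
  have := Tv _ Ff; rewrite -dline -md deriv_mcurve => sum0; rewrite -[RHS]sum0.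
  apply: eq_bigr => i _; rewrite mxE; congr (_ * _).
  by apply: meval_eq => j; rewrite d0.
pose M : 'M[K]_N := \matrix_(j, i) ((Q 0 i).[(- r)%:MP])^`M(j).@[y 0].
have MP (e : 'I_N -> {poly K}) : (forall j, (e j).[0] = y 0 j) ->
    velocity e 0 *m M = velocity (fun i => mcurve e (Q 0 i).[(- r)%:MP]) 0.
  move=> e0; apply/rowP => i; rewrite !mxE deriv_mcurve; apply: eq_bigr => j _.
  by rewrite !mxE mulrC; congr (_ * _); apply: meval_eq => k.
(* The two maps are inverse to each other only on [X]: each coordinate of [Q_{-r} Q_r] minus its
   variable vanishes on [X], so the tangent vector [v] kills its differential. *)
have wM : w *m M = v.
  rewrite MP //; apply/rowP => i; rewrite mxE md dline.
  set f := comp_mpoly _ _.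
  have f0 z : X z -> (f - 'X_i).@[z 0] = 0.
    move=> Xz; rewrite mevalB mevalXU meval_comp.
    have /rowP/(_ i) : Ga_act Q (- r) (Ga_act Q r z) = z by rewrite -QD // addNr Q0.
    rewrite mxE => <-; apply/eqP; rewrite subr_eq0; apply/eqP.
    by apply: meval_eq => j; rewrite tnth_mktuple mxE.
  have := Tv _ f0; under eq_bigr do rewrite mderivB mevalB mulrBl.
  rewrite sumrB => /eqP; rewrite subr_eq0 => /eqP ->.
  rewrite (bigD1 i) //= big1 => [|j ji].
    by rewrite mderivXU eqxx meval1 mul1r addr0.
  by rewrite mderivXU eq_sym (negbTE ji) meval0 mul0r.
have := span_s _ Tw => /(memv_img (linfun (mulmxr M))).
rewrite lfunE /= wM limg_span -!map_comp; congr (v \in <<_>>%VS).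
apply/eq_in_map => P sP /=; rewrite lfunE /= -!velocity_gcurve.
have Xy : X y by apply: QX.
have [_ P0 _] := sA P sP.
rewrite MP => [|j]; last by rewrite horner_gcurve P0.
apply/rowP => i; rewrite !mxE; congr (_^`().[0]); apply: poly_ext => t.
rewrite horner_mcurve horner_gcurve Ga_act_conj opprK -/y [in RHS]mxE.
by apply: meval_eq => j; rewrite horner_gcurve.
Qed.

End Curves.

(** * Algebraic independence along chains of irreducible sets *)

Local Notation subst_mpoly f := (mmap (@mpolyC _ _) f).

(** * Algebraic dependence by counting monomials *)

Section Dependence.

Variable K : closedFieldType.

Lemma msizeM_leq m (p q : {mpoly K[m]}) : (msize (p * q) <= msize p + msize q)%N.
Proof.
have [->|p0] := eqVneq p 0; first by rewrite mul0r msize0.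
have [->|q0] := eqVneq q 0; first by rewrite mulr0 msize0.
by rewrite msizeM // leq_pred.
Qed.

Lemma msize_exp_leq m (p : {mpoly K[m]}) k : (msize (p ^+ k) <= k * msize p + 1)%N.
Proof.
elim: k => [|k IH]; first by rewrite expr0 msize1.
by rewrite exprS mulSn -addnA (leq_trans (msizeM_leq _ _)) // leq_add2l.
Qed.

Lemma msize_prod_leq m r (G : 'I_r -> {mpoly K[m]}) :
  (msize (\prod_j G j) <= 1 + \sum_j msize (G j))%N.
Proof.
apply: (big_rec2 (fun p k => (msize p <= 1 + k)%N)) => [|j p k _ pk].
  by rewrite msize1.
by rewrite addnCA (leq_trans (msizeM_leq _ _)) // leq_add2l.
Qed.

(** A relation between the fractions [F_j / H_j], cleared of the denominator [prod_j H_j^n], is a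
    linear relation between [n^r] products. These involve at most [(n d)^m] monomials, which is less
    than [n^r]. *)
Lemma poly_dependence m r (F H : 'I_r -> {mpoly K[m]}) : (m < r)%N ->
  exists n (v : {ffun 'I_r -> 'I_n} -> K), (exists a, v a != 0) /\
    \sum_a v a *: \prod_j (F j ^+ a j * H j ^+ (n - a j)) = 0.
Proof.
move=> mr; pose d := (1 + \sum_j (msize (F j) + msize (H j) + 2))%N.
(* As [n > d^m] and [r > m], one has [n^r >= n^(m+1) > (n d)^m]. *)
pose n := (d ^ m).+1; pose B := (n * d)%N.
pose G (a : {ffun 'I_r -> 'I_n}) := \prod_j (F j ^+ a j * H j ^+ (n - a j)).
have sG a : (msize (G a) <= B)%N.
  have -> : B = (n * 1 + \sum_j (n * (msize (F j) + msize (H j) + 2)))%N.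
    by rewrite -big_distrr /= -mulnDr.
  apply: leq_trans (msize_prod_leq _) _; apply: leq_add; first by rewrite muln1.
  apply: leq_sum => j _; apply: leq_trans (msizeM_leq _ _) _.
  apply: leq_trans (leq_add (msize_exp_leq _ _) (msize_exp_leq _ _)) _.
  rewrite addnACA !mulnDr; apply: leq_add; last by rewrite leq_pmull.
  by apply: leq_add; rewrite leq_mul2r ?leq_subr ?orbT // ltnW ?orbT.
pose mon (b : {ffun 'I_m -> 'I_B}) : 'X_{1..m} := [multinom (b j : nat) | j < m].
pose A := \matrix_(a < #|{ffun 'I_r -> 'I_n}|, b < #|{ffun 'I_m -> 'I_B}|)
  (G (enum_val a))@_(mon (enum_val b)).
have kerA : kermx A != 0.
  rewrite -mxrank_eq0 mxrank_ker subn_eq0 -ltnNge.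
  apply: leq_ltn_trans (rank_leq_col _) _; rewrite !card_ffun !card_ord.
  apply: (@leq_trans (n ^ m.+1)); last by rewrite leq_pexp2l.
  by rewrite /B expnMn expnSr ltn_pmul2l ?expn_gt0.
pose v a := nz_row (kermx A) 0 (enum_rank a).
exists n, v; split.
  have : nz_row (kermx A) != 0 by rewrite nz_row_eq0.
  case/rV0Pn=> a va; exists (enum_val a).
  by rewrite /v enum_valK.
apply/mpolyP => k; rewrite mcoeff0 raddf_sum /=.
have [kB|kB] := ltnP (mdeg k) B; last first.
  apply: big1 => a _; rewrite mcoeffZ (memN_msupp_eq0 (_ : k \notin msupp (G a))) ?mulr0 //.
  by apply/negP => /(mmeasure_mnm_lt mdeg) /=; rewrite ltnNge (leq_trans (sG a)).
have kj j : (k j < B)%N.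
  by apply: leq_ltn_trans kB; rewrite mdegE (bigD1 j) //= leq_addr.
pose b : {ffun 'I_m -> 'I_B} := [ffun j => Ordinal (kj j)].
have -> : k = mon b by apply/mnmP => j; rewrite mnmE ffunE.
have /sub_kermxP/matrixP/(_ 0 (enum_rank b)) := nz_row_sub (kermx A).
rewrite !mxE => Ab; rewrite -[RHS]Ab (reindex (fun i : 'I_#|{ffun 'I_r -> 'I_n}| => enum_val i)) /=; last first.
  by apply: onW_bij; apply: enum_val_bij.
apply: eq_bigr => a _; rewrite mcoeffZ !mxE enum_rankK; congr (_ * _).
by rewrite /v enum_valK.
Qed.

End Dependence.

(** * From strict inclusions of irreducible sets to independent functions *)

Section AlgebraicIndependence.

Variables (K : closedFieldType) (N : nat).
Implicit Types (X Y Z : 'rV[K]_N -> Prop) (x : 'rV[K]_N) (f g h : {mpoly K[N]}).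

Definition vanish_on Z f := forall x, Z x -> f.@[x 0] = 0.

(** The zero sets of [f] and [g] are closed and cover [Z], so one of them contains [Z]. *)
Lemma irreducible_prime Z f g : irreducible Z -> vanish_on Z (f * g) ->
  vanish_on Z f \/ vanish_on Z g.
Proof.
case=> _ irrZ fg; apply: (irrZ (fun x => f.@[x 0] = 0) (fun x => g.@[x 0] = 0)).
- exists (eq f) => x; split=> [fx _ <-//|]; exact.
- exists (eq g) => x; split=> [gx _ <-//|]; exact.
- by move=> x /fg/eqP; rewrite mevalM mulf_eq0 => /orP[/eqP|/eqP]; [left | right].
Qed.

Definition alg_indep Z r (f : 'I_r -> {mpoly K[N]}) : Prop :=
  forall P, vanish_on Z (subst_mpoly f P) -> P = 0.

Definition fcons r (f : 'I_r -> {mpoly K[N]}) h (j : 'I_r.+1) : {mpoly K[N]} :=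
  if unlift ord_max j is Some j' then f j' else h.

(* View the last of r + 1 variables as the variable of a univariate polynomial. *)
Definition last_var r (P : {mpoly K[r.+1]}) : {poly {mpoly K[r]}} :=
  mmap (@polyC _ \o @mpolyC r K)
    (fun j => if unlift ord_max j is Some j' then ('X_j')%:P else 'X) P.

Definition subst_last r (f : 'I_r -> {mpoly K[N]}) h (Q : {poly {mpoly K[r]}}) :=
  (map_poly (subst_mpoly f) Q).[h].

End AlgebraicIndependence.

Lemma last_varK (K : closedFieldType) r (P : {mpoly K[r.+1]}) :
  subst_last (fun j => 'X_(lift ord_max j)) 'X_ord_max (last_var P) = P.
Proof.
rewrite /subst_last; elim/mpoly_ring_ind: P => [a|i|p q IHp IHq|p q IHp IHq].
- by rewrite /last_var mmapC /= map_polyC hornerC /= mmapC.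
- rewrite /last_var mmapX mmap1U; case: unliftP => [j ->|->].
    by rewrite map_polyC hornerC /= mmapX mmap1U.
  by rewrite map_polyX hornerX.
- by rewrite -{2}IHp -{2}IHq /last_var rmorphD rmorphD hornerD.
- by rewrite -{2}IHp -{2}IHq /last_var rmorphM rmorphM hornerM.
Qed.

Section AlgebraicIndependence.

Variables (K : closedFieldType) (N : nat).
Implicit Types (X Y Z : 'rV[K]_N -> Prop) (x : 'rV[K]_N) (f g h : {mpoly K[N]}).

Lemma subst_fcons r (f : 'I_r -> {mpoly K[N]}) h P :
  subst_mpoly (fcons f h) P = subst_last f h (last_var P).
Proof.
rewrite /subst_last; elim/mpoly_ring_ind: P => [a|i|p q IHp IHq|p q IHp IHq].
- by rewrite /last_var !mmapC /= map_polyC hornerC /= mmapC.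
- rewrite /last_var !mmapX !mmap1U /fcons; case: unliftP => [j _|_].
    by rewrite map_polyC hornerC /= mmapX mmap1U.
  by rewrite map_polyX hornerX.
- by rewrite [LHS]rmorphD /= IHp IHq /last_var rmorphD rmorphD hornerD.
- by rewrite [LHS]rmorphM /= IHp IHq /last_var rmorphM rmorphM hornerM.
Qed.

(** Write a relation on [Z] as [Q h + c], with [c] free of the last variable. On [Y] the function
    [h] is zero, so independence there gives [c = 0]; then [Q h] vanishes on the irreducible [Z],
    hence so does [Q], and induction on the degree concludes. *)
Lemma alg_indep_cons Y Z r (f : 'I_r -> {mpoly K[N]}) h :
  irreducible Z -> subvar Y Z -> vanish_on Y h -> ~ vanish_on Z h ->
  alg_indep Y f -> alg_indep Z (fcons f h).
Proof.
move=> irrZ YZ hY hZ fY P; rewrite subst_fcons => PZ.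
rewrite -(last_varK P) (_ : last_var P = 0); last first.
  elim/poly_ind: (last_var P) PZ => // Q c IH QZ.
  have QE : subst_last f h (Q * 'X + c%:P) = subst_last f h Q * h + subst_mpoly f c.
    by rewrite /subst_last rmorphD rmorphM /= map_polyX map_polyC hornerD hornerM hornerX hornerC.
  have c0 : c = 0.
    apply: fY => x Yx; have := QZ x (YZ x Yx).
    by rewrite QE mevalD mevalM hY // mulr0 add0r.
  have : vanish_on Z (subst_last f h Q * h).
    by move=> x /QZ; rewrite QE c0 rmorph0 addr0.
  by case/(irreducible_prime irrZ) => // /IH->; rewrite c0 mul0r addr0.
by rewrite /subst_last rmorph0 horner0.
Qed.

(** Each strict inclusion contributes one new function, which vanishes on the smaller set but not on
    the larger one. *)
Lemma chain_alg_indep X d C : irr_chain X d C ->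
  exists f : 'I_d -> {mpoly K[N]}, alg_indep (C d) f.
Proof.
elim: d => [|d IH] [Cirr Cinc].
  have [[_ [[x Cx] _]] _] := Cirr 0%N isT.
  exists (fun _ => 0) => P /(_ x Cx); rewrite (nvar0_mpolyC P) mmapC mevalC.
  by move=> ->.
have [|f fC] := IH.
  by split=> i id; [apply: Cirr | apply: Cinc]; apply: leq_trans id _.
have [sub nsub] := Cinc d (ltnSn d).
have [[_ irr] _] := Cirr d.+1 (leqnn _).
have [[[S SC] _] _] := Cirr d (leqnSn _).
have [h [Sh hC]] : exists h, S h /\ ~ vanish_on (C d.+1) h.
  apply: NNPP => nh; apply: nsub => x Cx; apply/SC => h Sh.
  by apply: NNPP => hx; apply: nh; exists h; split=> // /(_ x Cx).
exists (fcons f h); apply: (alg_indep_cons irr sub) fC => // x /SC; exact.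
Qed.

End AlgebraicIndependence.

(** * Additive group actions by shears *)

Section PowerMonomials.

Variables (K : closedFieldType) (N : nat).

Definition pmon (A : pred 'I_N) (e : 'I_N -> nat) : {mpoly K[N]} :=
  \prod_(q | A q) 'X_q ^+ e q.

Lemma meval_pmon A e (x : 'I_N -> K) : (pmon A e).@[x] = \prod_(q | A q) x q ^+ e q.
Proof. by rewrite rmorph_prod; apply: eq_bigr => q _; rewrite rmorphXn /= mevalXU. Qed.

Lemma pmonE (A : pred 'I_N) (e : 'I_N -> nat) :
  pmon A e = 'X_[[multinom (if A q then e q else 0)%N | q < N]].
Proof.
rewrite mpolyXE_id /pmon big_mkcond; apply: eq_bigr => q _.
by rewrite mnmE; case: (A q).
Qed.

Lemma deriv_pmon (A : pred 'I_N) (e : 'I_N -> nat) q (x : 'I_N -> K) :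
  ((pmon A e)^`M(q)).@[x] = if A q then
    (e q)%:R * x q ^+ (e q).-1 * \prod_(q' | A q' && (q' != q)) x q' ^+ e q' else 0.
Proof.
rewrite pmonE mderivX mevalZ mnmE; case: ifP => Aq; last by rewrite mul0r.
rewrite mpolyXE_id rmorph_prod /= (bigD1 q) //= mulrA; congr (_ * _ * _).
  by rewrite rmorphXn /= mevalXU mnmBE mnmE mnm1E eqxx Aq subn1.
rewrite big_mkcond [RHS]big_mkcond; apply: eq_bigr => q' _ /=.
case: eqVneq => [->|q'q]; first by rewrite andbF.
rewrite rmorphXn /= mevalXU mnmBE mnmE mnm1E eq_sym (negbTE q'q) subn0 andbT.
by case: (A q').
Qed.

Definition evalp (s : K) (x : 'rV[K]_N) (P : {poly {mpoly K[N]}}) : K :=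
  (P.[s%:MP]).@[x 0].

Lemma evalpD s x : {morph evalp s x : P Q / P + Q}.
Proof. by move=> P Q; rewrite /evalp hornerD rmorphD. Qed.

Lemma evalpM s x : {morph evalp s x : P Q / P * Q}.
Proof. by move=> P Q; rewrite /evalp hornerM rmorphM. Qed.

Lemma evalpC s x f : evalp s x f%:P = f.@[x 0].
Proof. by rewrite /evalp hornerC. Qed.

Lemma evalpX s x : evalp s x 'X = s.
Proof. by rewrite /evalp hornerX mevalC. Qed.

Lemma evalp_exp s x P n : evalp s x (P ^+ n) = evalp s x P ^+ n.
Proof.
elim: n => [|n IH]; last by rewrite !exprS evalpM IH.
by rewrite !expr0 -[1]/(1%:P) evalpC meval1.
Qed.

Lemma evalp_sum s x (T : Type) (r : seq T) (F : T -> {poly {mpoly K[N]}}) :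
  evalp s x (\sum_(i <- r) F i) = \sum_(i <- r) evalp s x (F i).
Proof.
apply: (big_morph (evalp s x) (evalpD s x)).
by rewrite -[0]/(0%:P) evalpC meval0.
Qed.

Lemma evalp_lin s x (f g : {mpoly K[N]}) :
  evalp s x (f%:P + 'X * g%:P) = f.@[x 0] + s * g.@[x 0].
Proof.
rewrite evalpD; congr (_ + _); first exact: evalpC.
by rewrite evalpM; congr (_ * _); [exact: evalpX | exact: evalpC].
Qed.

Lemma evalp_quad s x (f g h k : {mpoly K[N]}) E :
  evalp s x (f%:P + g%:P * (E * h%:P + E ^+ 2 * k%:P)) =
  f.@[x 0] + g.@[x 0] * (evalp s x E * h.@[x 0] + evalp s x E ^+ 2 * k.@[x 0]).
Proof.
rewrite evalpD; congr (_ + _); first exact: evalpC.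
rewrite evalpM; congr (_ * _); first exact: evalpC.
rewrite evalpD; congr (_ + _); rewrite evalpM; congr (_ * _); try exact: evalpC.
exact: evalp_exp.
Qed.

Lemma evalp_incr s x (f g h : {mpoly K[N]}) (l : nat) :
  evalp s x (f%:P * ('X * \sum_(i < l) (g%:P + 'X * h%:P) ^+ (l.-1 - i) * g%:P ^+ i)) =
  f.@[x 0] * (s * \sum_(i < l) (g.@[x 0] + s * h.@[x 0]) ^+ (l.-1 - i) * g.@[x 0] ^+ i).
Proof.
rewrite evalpM; congr (_ * _); first exact: evalpC.
rewrite evalpM; congr (_ * _); first exact: evalpX.
rewrite evalp_sum; apply: eq_bigr => i _.
rewrite evalpM; congr (_ * _); rewrite evalp_exp; congr (_ ^+ _).
  exact: evalp_lin.
exact: evalpC.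
Qed.

End PowerMonomials.

Section BlockMonomials.

Variables (K : closedFieldType) (N : nat) (I : finType).
Variables (blk : 'I_N -> I) (L : 'I_N -> nat).
Implicit Types (x : 'rV[K]_N) (p q : 'I_N) (i : I).

Definition block_mon i x : K := \prod_(q | blk q == i) x 0 q ^+ L q.
Definition block_cofac p x : K := \prod_(q | (blk q == blk p) && (q != p)) x 0 q ^+ L q.
Definition block_partial p x : K := (L p)%:R * x 0 p ^+ (L p).-1 * block_cofac p x.

Lemma bmon_split p x : block_mon (blk p) x = x 0 p ^+ L p * block_cofac p x.
Proof. by rewrite /block_mon (bigD1 p) //= mulrC mulrC. Qed.

Definition pencil (al ga : I -> K) (e0 e1 : I) x : Prop :=
  forall i, block_mon i x = al i * block_mon e0 x + ga i * block_mon e1 x.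

End BlockMonomials.

(** * A general family of shear flows *)

Section Flow.

Variables (K : closedFieldType) (N : nat) (I : finType).
Variables (blk : 'I_N -> I) (L : 'I_N -> nat).
Variables (u : 'I_N) (J : pred I) (a : I -> 'I_N) (e : 'I_N -> nat).
Variables (Y : {mpoly K[N]}) (G : I -> {mpoly K[N]}) (H : I -> K).
Implicit Types (x : 'rV[K]_N) (p q : 'I_N) (k : I) (s t : K).

Let l := L u.

(* T_u moves by s R Y and T_{a k} by R_k (E G_k + E^2 R H_k), where R = prod_k w_k,
   R_k = R / w_k and E is the increment making the block monomial of u grow by R Y E;
   thus T_{a k} w_k grows by R (E G_k + E^2 R H_k). *)
Definition wmon k : {mpoly K[N]} := pmon K (fun q => (blk q == k) && (q != a k)) e.
Definition rmon : {mpoly K[N]} := \prod_(k | J k) wmon k.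
Definition rmon' k : {mpoly K[N]} := \prod_(k' | J k' && (k' != k)) wmon k'.
Definition umon : {mpoly K[N]} := pmon K (fun q => (blk q == blk u) && (q != u)) L.

(** This is [E = umon * ((T_u + s R Y)^l - T_u^l) / (R Y)]; expanding the quotient as a geometric
    sum keeps it a polynomial, also where [R Y = 0]. *)
Definition fincr : {poly {mpoly K[N]}} :=
  umon%:P * ('X * \sum_(i < l) (('X_u)%:P + 'X * (rmon * Y)%:P) ^+ (l.-1 - i) * ('X_u)%:P ^+ i).

Definition flow : Ga_map K N := \row_p
  (if p == u then ('X_p)%:P + 'X * (rmon * Y)%:P
   else if J (blk p) && (p == a (blk p)) then
     ('X_p)%:P + (rmon' (blk p))%:P *
       (fincr * (G (blk p))%:P + fincr ^+ 2 * (H (blk p) *: rmon)%:P)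
   else ('X_p)%:P).

Definition power_incr s (T b : K) : K :=
  s * \sum_(i < l) (T + s * b) ^+ (l.-1 - i) * T ^+ i.

Lemma power_incrE s T b : b * power_incr s T b = (T + s * b) ^+ l - T ^+ l.
Proof. by rewrite subrXX addrAC subrr add0r mulrA [b * s]mulrC. Qed.

Lemma power_incrD s t T b :
  power_incr (s + t) T b = power_incr s (T + t * b) b + power_incr t T b.
Proof.
have [->|b0] := eqVneq b 0.
  by rewrite /power_incr !mulr0 !addr0 mulrDl.
apply: (mulfI b0); rewrite mulrDr !power_incrE subrKA.
by congr (_ ^+ _ - _); ring.
Qed.

Definition incr s x : K := umon.@[x 0] * power_incr s (x 0 u) (rmon.@[x 0] * Y.@[x 0]).

Lemma evalp_fincr s x : evalp s x fincr = incr s x.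
Proof.
by rewrite /fincr evalp_incr mevalXU mevalM.
Qed.

Lemma flowE s x p : Ga_act flow s x 0 p =
  if p == u then x 0 p + s * (rmon.@[x 0] * Y.@[x 0])
  else if J (blk p) && (p == a (blk p)) then
    x 0 p + (rmon' (blk p)).@[x 0] * (incr s x * (G (blk p)).@[x 0]
             + incr s x ^+ 2 * (H (blk p) * rmon.@[x 0]))
  else x 0 p.
Proof.
rewrite mxE -/(evalp s x _) mxE.
have RY : (rmon * Y).@[x 0] = rmon.@[x 0] * Y.@[x 0] by rewrite mevalM.
case: ifP => _; [|case: ifP => _].
- by rewrite evalp_lin RY mevalXU.
- by rewrite evalp_quad evalp_fincr mevalXU mevalZ.
- by rewrite evalpC mevalXU.
Qed.

Hypothesis uJ : ~~ J (blk u).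
Hypothesis blk_a : forall k, J k -> blk (a k) = k.

Lemma flow_fix s x p : p != u -> ~~ (J (blk p) && (p == a (blk p))) ->
  Ga_act flow s x 0 p = x 0 p.
Proof. by move=> /negbTE pu /negbTE pa; rewrite flowE pu pa. Qed.

Lemma flow_wmon s x k : J k -> (wmon k).@[Ga_act flow s x 0] = (wmon k).@[x 0].
Proof.
move=> Jk; rewrite !meval_pmon; apply: eq_bigr => q /andP[/eqP qk qa].
rewrite flow_fix //; first by apply: contraNneq uJ => <-; rewrite qk.
by rewrite qk (negbTE qa) andbF.
Qed.

Lemma flow_rmon s x : rmon.@[Ga_act flow s x 0] = rmon.@[x 0].
Proof. by rewrite !rmorph_prod; apply: eq_bigr => k Jk; apply: flow_wmon. Qed.

Lemma flow_rmon' s x k : (rmon' k).@[Ga_act flow s x 0] = (rmon' k).@[x 0].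
Proof. by rewrite !rmorph_prod; apply: eq_bigr => k' /andP[Jk _]; apply: flow_wmon. Qed.

Lemma flow_umon s x : umon.@[Ga_act flow s x 0] = umon.@[x 0].
Proof.
rewrite !meval_pmon; apply: eq_bigr => q /andP[/eqP qu nqu].
by rewrite flow_fix // qu (negbTE uJ).
Qed.

Lemma flow_u s x : Ga_act flow s x 0 u = x 0 u + s * (rmon.@[x 0] * Y.@[x 0]).
Proof. by rewrite flowE eqxx. Qed.

Lemma flow_a s x k : J k -> Ga_act flow s x 0 (a k) =
  x 0 (a k) + (rmon' k).@[x 0] * (incr s x * (G k).@[x 0]
             + incr s x ^+ 2 * (H k * rmon.@[x 0])).
Proof.
move=> Jk; rewrite flowE blk_a // Jk eqxx ifN //.
by apply: contraNneq uJ => <-; rewrite blk_a.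
Qed.

Lemma rmon_split k : J k -> rmon = wmon k * rmon' k.
Proof. by move=> Jk; rewrite /rmon (bigD1 k). Qed.

Lemma flow_wa s x k : J k -> Ga_act flow s x 0 (a k) * (wmon k).@[x 0] =
  x 0 (a k) * (wmon k).@[x 0] + rmon.@[x 0] * (incr s x * (G k).@[x 0]
             + incr s x ^+ 2 * (H k * rmon.@[x 0])).
Proof.
by move=> Jk; rewrite flow_a // mulrDl (rmon_split Jk) mevalM; congr (_ + _); ring.
Qed.

Lemma umonE x : umon.@[x 0] = block_cofac blk L u x.
Proof. by rewrite meval_pmon. Qed.

Lemma flow_bmon_u s x : block_mon blk L (blk u) (Ga_act flow s x) =
  block_mon blk L (blk u) x + rmon.@[x 0] * Y.@[x 0] * incr s x.
Proof.
rewrite !bmon_split -!umonE flow_umon flow_u /incr [in RHS]mulrCA power_incrE -/l.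
by move: (_ ^+ l) (_ ^+ l) => T' T; ring.
Qed.

Lemma flow_bmon_fix s x i : ~~ J i -> i != blk u ->
  block_mon blk L i (Ga_act flow s x) = block_mon blk L i x.
Proof.
move=> Ji iu; apply: eq_bigr => q /eqP qi; rewrite flow_fix //.
  by apply: contraNneq iu => <-; rewrite qi.
by rewrite qi (negbTE Ji).
Qed.

Hypothesis flow_Y : forall s x, Y.@[Ga_act flow s x 0] = Y.@[x 0].
Hypothesis flow_G : forall s x k, J k ->
  (G k).@[Ga_act flow s x 0] = (G k).@[x 0] + 2 * incr s x * (H k * rmon.@[x 0]).

Lemma incrD s t x : incr (s + t) x = incr s (Ga_act flow t x) + incr t x.
Proof. by rewrite /incr flow_umon flow_u flow_rmon flow_Y power_incrD mulrDr. Qed.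

Lemma incr0 x : incr 0 x = 0.
Proof. by rewrite /incr /power_incr mul0r mulr0. Qed.

Lemma flow0 x : Ga_act flow 0 x = x.
Proof.
apply/rowP => p; rewrite flowE incr0; case: ifP => _; first by rewrite mul0r addr0.
by case: ifP => _ //; rewrite expr0n /= !mul0r addr0 mulr0 addr0.
Qed.

(** Let [E] and [E'] be the increments over time [t] and then over time [s]. By [flow_G] the
    increments of [T_{a k}] add up correctly, because [E G + E^2 R H + E' (G + 2 E R H) + E'^2 R H =
    (E + E') G + (E + E')^2 R H]. *)
Lemma flowD s t x : Ga_act flow (s + t) x = Ga_act flow s (Ga_act flow t x).
Proof.
apply/rowP => p; rewrite [RHS]flowE [LHS]flowE.
have [->|pu] := eqVneq p u; first by rewrite flow_u flow_rmon flow_Y; ring.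
rewrite [Ga_act flow t x 0 p]flowE (negbTE pu); case: ifP => [/andP[Jp _]|//].
by rewrite flow_rmon' flow_rmon flow_G // incrD; ring.
Qed.

Lemma Ga_action_flow (X : 'rV[K]_N -> Prop) :
  (forall s x, X x -> X (Ga_act flow s x)) -> Ga_action X flow.
Proof. by move=> XX; split=> *; [apply: XX | apply: flow0 | apply: flowD]. Qed.

(** To first order in [s], [E] is [s] times the partial derivative of the block monomial of [u] by
    [T_u], so the quadratic term in [E] does not contribute. *)
Lemma orbit_tangent_flow x p : orbit_tangent x flow 0 p =
  if p == u then rmon.@[x 0] * Y.@[x 0]
  else if J (blk p) && (p == a (blk p)) then
    (rmon' (blk p)).@[x 0] * (G (blk p)).@[x 0] * block_partial blk L u x
  else 0.
Proof.
rewrite -velocity_gcurve mxE.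
pose E : {poly K} := (umon.@[x 0])%:P * ('X * \sum_(i < l)
  ((x 0 u)%:P + 'X * (rmon.@[x 0] * Y.@[x 0])%:P) ^+ (l.-1 - i) * (x 0 u)%:P ^+ i).
have EE s : E.[s] = incr s x.
  rewrite hornerM hornerC hornerM hornerX horner_sum; congr (_ * (_ * _)).
  by apply: eq_bigr => i _; rewrite !hornerE.
have E0 : E.[0] = 0 by rewrite EE incr0.
have dE : E^`().[0] = block_partial blk L u x.
  have dX (S : {poly K}) : ('X * S)^`().[0] = S.[0].
    by rewrite derivM derivX mul1r hornerD hornerM hornerX mul0r addr0.
  rewrite /E mul_polyC derivZ hornerZ dX horner_sum /block_partial umonE -/l.
  rewrite mulrC; congr (_ * _).
  rewrite -[l in l%:R]card_ord mulr_natl -sumr_const; apply: eq_bigr => i _.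
  rewrite !hornerE ?mul0r ?addr0 -exprD subnK //.
  by rewrite -ltnS prednK // (leq_ltn_trans _ (ltn_ord i)).
clearbody E.
have -> : gcurve flow x p = if p == u then (x 0 p)%:P + 'X * (rmon.@[x 0] * Y.@[x 0])%:P
  else if J (blk p) && (p == a (blk p)) then
    (x 0 p)%:P + ((rmon' (blk p)).@[x 0])%:P * (E * ((G (blk p)).@[x 0])%:P
             + E ^+ 2 * (H (blk p) * rmon.@[x 0])%:P)
  else (x 0 p)%:P.
  apply: poly_ext => s; rewrite horner_gcurve flowE.
  case: ifP => _; [|case: ifP => _]; last by rewrite hornerC.
    by rewrite hornerD hornerM hornerX !hornerC.
  by rewrite hornerD hornerM hornerD !hornerM EE !hornerC.
case: ifP => _; [|case: ifP => _].
- by rewrite derivD derivC add0r derivM derivX derivC mulr0 addr0 mul1r hornerC.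
- rewrite derivD derivC add0r mul_polyC derivZ hornerZ derivD !derivM !derivC !mulr0 !addr0.
  rewrite hornerD !hornerM hornerD !hornerM !hornerC E0 dE.
  by ring.
- by rewrite derivC horner0.
Qed.

End Flow.

(** * Shear flows that preserve the pencil equations *)

Section PencilActions.

Variables (K : closedFieldType) (N : nat) (I : finType).
Variables (blk : 'I_N -> I) (L : 'I_N -> nat).
Variables (al ga : I -> K) (e0 e1 : I).
Hypotheses (al0 : al e0 = 1) (ga0 : ga e0 = 0) (al1 : al e1 = 0) (ga1 : ga e1 = 1).
Hypothesis L_gt0 : forall q, (0 < L q)%N.
Implicit Types (x : 'rV[K]_N) (p q : 'I_N) (i k : I).

Local Notation bmon := (block_mon blk L).
Local Notation cofac := (block_cofac blk L).
Local Notation dmon := (block_partial blk L).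
Local Notation X := (pencil blk L al ga e0 e1).

Lemma coord_neq0 x q : bmon (blk q) x != 0 -> x 0 q != 0.
Proof. by rewrite bmon_split mulf_eq0 negb_or expf_eq0 L_gt0 /= => /andP[]. Qed.

Lemma pencil_shift x y (d0 d1 : K) :
  (forall k, bmon k y = bmon k x + (al k * d0 + ga k * d1)) -> X x -> X y.
Proof.
move=> yx Xx k; rewrite !yx Xx al0 ga0 al1 ga1.
by ring.
Qed.

(** Take constant [Y] and [G], [H = 0] and [u = a i1], the one chosen variable whose exponent may
    exceed 1. Each block monomial then grows by [R E (be k)], and the equations persist because [be]
    is a combination of [al] and [ga]. In the last clause the factor [dmon q x] turns the tangent
    vector, up to a scalar, into [be] placed on the chosen variables. *)
Lemma elementary_action (i0 i1 : I) (a : I -> 'I_N) (A B : K) :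
  let be k := al k * A + ga k * B in
  i1 != i0 -> be i0 = 0 -> (forall k, k != i0 -> blk (a k) = k) ->
  (forall k, k != i0 -> k != i1 -> L (a k) = 1%N) ->
  exists P, [/\ Ga_action X P,
    forall x k, k != i0 -> orbit_tangent x P 0 (a k) =
      be k * \prod_(k' | (k' != i0) && (k' != k)) dmon (a k') x
  & forall x q, dmon q x * orbit_tangent x P 0 q =
      (\prod_(k | k != i0) dmon (a k) x) *
      (be (blk q) * ((blk q != i0) && (q == a (blk q)))%:R)].
Proof.
move=> be i10 be0 blk_a La.
pose J k := (k != i0) && (k != i1); pose u := a i1.
have bu : blk u = i1 by rewrite blk_a.
have uJ : ~~ J (blk u) by rewrite bu /J eqxx andbF.
have blkJ k : J k -> blk (a k) = k by case/andP => /blk_a.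
pose G k : {mpoly K[N]} := (be k)%:MP; pose Y := G i1; pose H (k : I) : K := 0.
pose P := flow blk L u J a L Y G H.
have wd k x : J k -> (wmon K blk a L k).@[x 0] = dmon (a k) x.
  case/andP => ki0 ki1; rewrite meval_pmon /block_partial /block_cofac La // blk_a //.
  by rewrite expr0 !mul1r.
have rd x : (rmon K blk J a L).@[x 0] = \prod_(k | J k) dmon (a k) x.
  by rewrite rmorph_prod; apply: eq_bigr => k Jk; apply: wd.
have r'd k x : (rmon' K blk J a L k).@[x 0] = \prod_(k' | J k' && (k' != k)) dmon (a k') x.
  by rewrite rmorph_prod; apply: eq_bigr => k' /andP[Jk _]; apply: wd.
have tu x : orbit_tangent x P 0 u = (\prod_(k | J k) dmon (a k) x) * be i1.
  by rewrite orbit_tangent_flow eqxx rd mevalC.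
have tJ x k : J k -> orbit_tangent x P 0 (a k) =
    be k * ((\prod_(k' | J k' && (k' != k)) dmon (a k') x) * dmon u x).
  move=> Jk; rewrite orbit_tangent_flow blkJ // Jk eqxx ifN ?r'd ?mevalC; first by ring.
  by apply: contraNneq uJ => <-; rewrite blkJ.
exists P; split.
- apply: Ga_action_flow => // [s x|s x k Jk|s x Xx]; try by rewrite !mevalC.
    by rewrite !mevalC !(mul0r, mulr0) addr0.
  set E := incr blk L u J a L Y s x; set R := (rmon K blk J a L).@[x 0].
  apply: (@pencil_shift x _ (R * E * A) (R * E * B)) => // k.
  transitivity (bmon k x + R * E * be k); last by rewrite /be; ring.
  have [->|ki1] := eqVneq k i1.
    by rewrite -{1}bu flow_bmon_u // bu mevalC; congr (_ + _); rewrite -/R -/E; ring.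
  have [->|ki0] := eqVneq k i0.
    by rewrite be0 mulr0 addr0 flow_bmon_fix ?bu 1?eq_sym // /J eqxx.
  have Jk : J k by rewrite /J ki0.
  have bE y : bmon k y = y 0 (a k) * (wmon K blk a L k).@[y 0].
    by rewrite -{1}(blkJ k Jk) bmon_split La // meval_pmon /block_cofac blkJ.
  by rewrite !bE flow_wmon // flow_wa // mevalC !(mul0r, mulr0) addr0 -/R -/E mulrA.
- move=> x k ki0; have [->|ki1] := eqVneq k i1; first by rewrite tu mulrC.
  rewrite tJ; last by rewrite /J ki0.
  congr (_ * _); rewrite [RHS](bigD1 i1) /=; last by rewrite i10 eq_sym.
  rewrite mulrC; congr (_ * _); apply: eq_bigl => k'; rewrite /J.
  by case: (k' == i0); case: (k' == i1); case: (k' == k).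
- move=> x q; have prodE : \prod_(k | k != i0) dmon (a k) x =
      dmon u x * \prod_(k | J k) dmon (a k) x by rewrite (bigD1 i1).
  rewrite prodE; have [->|qu] := eqVneq q u.
    by rewrite tu bu i10 eqxx mulr1; ring.
  rewrite orbit_tangent_flow (negbTE qu) /=.
  have [bq0|bq0] := eqVneq (blk q) i0.
    by rewrite /J bq0 eqxx /= !mulr0.
  have [qa|qa] := eqVneq q (a (blk q)); last by rewrite andbF !mulr0.
  have [bq1|bq1] := eqVneq (blk q) i1.
    by move: qu; rewrite qa bq1 eqxx.
  have Jq : J (blk q) by rewrite /J bq0 bq1.
  rewrite Jq /= r'd mevalC [\prod_(k | J k) _](bigD1 (blk q)) //= -qa.
  by ring.
Qed.

(* With h_0^2 = t_{e0}, h_1^2 = t_{e1}, the block monomial t_i factors as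
   (r h_1 + m h_0) (r h_1 - m h_0); the action fixes the first factor. *)
Lemma square_action (i : I) (a : I -> 'I_N) (r m : K) :
  (2 : K) != 0 -> r ^+ 2 = ga i -> m ^+ 2 = - al i -> r != 0 -> m != 0 ->
  i != e0 -> i != e1 ->
  (forall k, blk (a k) = k) ->
  (forall k, k != i -> k != e0 -> k != e1 -> L (a k) = 1%N) ->
  L (a e0) = 2 -> L (a e1) = 2 ->
  (forall q, (blk q == e0) || (blk q == e1) -> (2 %| L q)%N) ->
  let ha k x := x 0 (a k) * \prod_(q | (blk q == k) && (q != a k)) x 0 q ^+ (L q)./2 in
  let be x k := ga k * (ha e1 x / r) - al k * (ha e0 x / m) in
  [/\ forall x, ha e0 x ^+ 2 = bmon e0 x, forall x, ha e1 x ^+ 2 = bmon e1 x &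
  exists P (R : 'rV[K]_N -> K), [/\ Ga_action X P,
    forall x, (forall k, k != i -> bmon k x != 0) -> R x != 0,
    forall x, orbit_tangent x P 0 (a i) = R x * be x i
  & forall x q, dmon q x * orbit_tangent x P 0 q =
      (R x * dmon (a i) x) * (be x (blk q) * (q == a (blk q))%:R)]].
Proof.
move=> two0 r2 m2 r0 m0 ie0 ie1 blk_a La La0 La1 Leven ha be.
pose sq k := (k == e0) || (k == e1).
(* Halving the exponents in blocks [e0] and [e1] makes [hp] the square root of the block monomial
   there. *)
pose e q := if sq (blk q) then (L q)./2 else L q.
pose w k := wmon K blk a e k.
have wE k x : (w k).@[x 0] = \prod_(q | (blk q == k) && (q != a k)) x 0 q ^+ e q.
  by rewrite meval_pmon.
have haE k x : sq k -> x 0 (a k) * (w k).@[x 0] = ha k x.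
  move=> sk; rewrite wE; congr (_ * _); apply: eq_bigr => q /andP[/eqP qk _].
  by rewrite /e qk sk.
have e01 : e0 != e1.
  by apply: contraTneq (oner_neq0 K) => e01; rewrite -al0 e01 al1 eqxx.
have w2 k x : sq k -> (w k).@[x 0] ^+ 2 = cofac (a k) x.
  move=> sk; rewrite wE -prodrXl /block_cofac blk_a; apply: eq_bigr => q /andP[/eqP qk _].
  rewrite /e qk sk -exprM; congr (_ ^+ _).
  by rewrite muln2 even_halfK // -dvdn2 Leven // qk.
have ha2 k x : sq k -> ha k x ^+ 2 = bmon k x.
  move=> sk; rewrite -haE // exprMn w2 // -{3}(blk_a k) bmon_split; congr (_ ^+ _ * _).
  by case/orP: sk => /eqP ->.
split=> [x|x|]; [by rewrite ha2 /sq ?eqxx | by rewrite ha2 /sq ?eqxx ?orbT |].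
pose J k := k != i.
pose hp k : {mpoly K[N]} := 'X_(a k) * w k.
have hpE k x : sq k -> (hp k).@[x 0] = ha k x by move=> sk; rewrite mevalM mevalXU haE.
have s0 : sq e0 by rewrite /sq eqxx.
have s1 : sq e1 by rewrite /sq eqxx orbT.
pose Y : {mpoly K[N]} := r *: hp e1 + m *: hp e0.
(* The flow changes [h_0] by [- R E / (2 m)] and [h_1] by [R E / (2 r)], which leaves
   [Y = r h_1 + m h_0] fixed. For the other blocks, [G] and [H] are the coefficients of [R E] and
   [(R E)^2] in the resulting change of [al_k h_0^2 + ga_k h_1^2]. *)
pose G k : {mpoly K[N]} :=
  if k == e0 then (- (2 * m)^-1)%:MP else if k == e1 then ((2 * r)^-1)%:MP
  else (ga k / r) *: hp e1 - (al k / m) *: hp e0.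
pose H0 k : K := al k / (4 * m ^+ 2) + ga k / (4 * r ^+ 2).
pose H k : K := if sq k then 0 else H0 k.
pose u := a i.
have bu : blk u = i by rewrite blk_a.
have uJ : ~~ J (blk u) by rewrite bu /J eqxx.
have blkJ k : J k -> blk (a k) = k by [].
have J0 : J e0 by rewrite /J eq_sym.
have J1 : J e1 by rewrite /J eq_sym.
pose P := flow blk L u J a e Y G H.
have YE x : Y.@[x 0] = r * ha e1 x + m * ha e0 x by rewrite mevalD !mevalZ !hpE.
have G0 x : (G e0).@[x 0] = - (2 * m)^-1 by rewrite /G eqxx mevalC.
have G1 x : (G e1).@[x 0] = (2 * r)^-1.
  by rewrite /G eq_sym (negbTE e01) eqxx mevalC.
have GE x k : ~~ sq k -> (G k).@[x 0] = be x k.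
  rewrite negb_or => /andP[/negbTE k0 /negbTE k1]; rewrite /G k0 k1.
  by rewrite mevalB !mevalZ !hpE // /be; ring.
pose E s x := incr blk L u J a e Y s x.
pose R x := (rmon K blk J a e).@[x 0].
have four0 : (4 : K) != 0 by rewrite (_ : 4 = 2 * 2) ?mulf_neq0 // -natrM.
have fha0 s x : ha e0 (Ga_act P s x) = ha e0 x - R x * E s x / (2 * m).
  rewrite -!haE // flow_wmon // flow_wa // G0 /H s0 -/(R x) -/(E s x).
  by ring.
have fha1 s x : ha e1 (Ga_act P s x) = ha e1 x + R x * E s x / (2 * r).
  rewrite -!haE // flow_wmon // flow_wa // G1 /H s1 -/(R x) -/(E s x).
  by ring.
have YB x : Y.@[x 0] = be x i.
  by rewrite YE /be -r2 -(opprK (al i)) -m2; field; rewrite r0 m0.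
exists P, R; split.
- apply: Ga_action_flow => // [s x|s x k Jk|s x Xx].
  + by rewrite !YE fha0 fha1; field; rewrite r0 m0 two0.
  + have [/orP[/eqP->|/eqP->]|k01] := boolP (sq k).
    * by rewrite !G0 /H s0 !(mul0r, mulr0) addr0.
    * by rewrite !G1 /H s1 !(mul0r, mulr0) addr0.
    rewrite !GE // /be fha0 fha1 /H (negbTE k01) /H0 -/(E s x) -/(R x).
    by field; rewrite r0 m0 two0 four0.
  pose d0 := ha e0 (Ga_act P s x) ^+ 2 - ha e0 x ^+ 2.
  pose d1 := ha e1 (Ga_act P s x) ^+ 2 - ha e1 x ^+ 2.
  have d0E : d0 = - (R x * E s x) * (ha e0 x / m) + (R x * E s x) ^+ 2 / (4 * m ^+ 2).
    by rewrite /d0 fha0; field; rewrite m0 two0 four0.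
  have d1E : d1 = (R x * E s x) * (ha e1 x / r) + (R x * E s x) ^+ 2 / (4 * r ^+ 2).
    by rewrite /d1 fha1; field; rewrite r0 two0 four0.
  apply: (@pencil_shift x _ d0 d1) => // k.
  have [/orP[/eqP->|/eqP->]|k01] := boolP (sq k).
  + by rewrite al0 ga0 mul1r mul0r addr0 /d0 !ha2 // addrC subrK.
  + by rewrite al1 ga1 mul1r mul0r add0r /d1 !ha2 // addrC subrK.
  have -> : al k * d0 + ga k * d1 = R x * E s x * be x k + (R x * E s x) ^+ 2 * H0 k.
    by rewrite d0E d1E /be /H0; field; rewrite r0 m0 four0.
  have [->|ki] := eqVneq k i.
    (* In [t_i = Y (r h_1 - m h_0)] the first factor is fixed and the second grows by [R E], so
       there is no quadratic term. *)
    have -> : H0 i = 0.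
      by rewrite /H0 -r2 -(opprK (al i)) -m2; field; rewrite r0 m0 four0.
    rewrite mulr0 addr0 -{1}bu flow_bmon_u // bu YB; congr (_ + _).
    by rewrite -/(E s x) -/(R x); ring.
  have Jk : J k by [].
  have [k0 k1] : k != e0 /\ k != e1 by apply/andP; rewrite -negb_or.
  have bE y : bmon k y = y 0 (a k) * (w k).@[y 0].
    rewrite -{1}(blkJ k Jk) bmon_split La // wE /block_cofac blk_a.
    by congr (_ * _); apply: eq_bigr => q /andP[/eqP qk _]; rewrite /e qk (negbTE k01).
  rewrite !bE flow_wmon // flow_wa // GE // /H (negbTE k01) -/(E s x) -/(R x).
  by ring.
- move=> x tx; rewrite /R rmorph_prod; apply/prodf_neq0 => k ki.
  rewrite /= meval_pmon; apply/prodf_neq0 => q /andP[/eqP qk _]; apply: expf_neq0.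
  by apply: coord_neq0; rewrite qk tx.
- by move=> x; rewrite orbit_tangent_flow eqxx YB.
- move=> x q; have [->|qu] := eqVneq q u.
    rewrite orbit_tangent_flow eqxx YB bu eqxx -/(R x) /u /= mulr1.
    by ring.
  rewrite orbit_tangent_flow (negbTE qu) /=.
  have [qa|qa] := eqVneq q (a (blk q)); last by rewrite andbF !mulr0.
  have [bqi|bqi] := eqVneq (blk q) i; first by move: qu; rewrite qa bqi eqxx.
  have Jq : J (blk q) by [].
  set k := blk q in qa bqi Jq *; rewrite Jq qa.
  rewrite /R (@rmon_split K N I blk J a e k Jq) mevalM -/(w k) /=.
  set R' := (rmon' _ _ _ _ _ _).@[_]; rewrite -/u mulr1.
  have [/orP[/eqP k0|/eqP k1]|k01] := boolP (sq k).
  + have d0 : dmon (a e0) x = 2 * x 0 (a e0) * (w e0).@[x 0] ^+ 2.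
      by rewrite /block_partial La0 expr1 -w2.
    rewrite k0 G0 d0 /be ga0 al0 -(haE e0) //.
    by field; rewrite m0 r0 two0.
  + have d1 : dmon (a e1) x = 2 * x 0 (a e1) * (w e1).@[x 0] ^+ 2.
      by rewrite /block_partial La1 expr1 -w2.
    rewrite k1 G1 d1 /be ga1 al1 -(haE e1) //.
    by field; rewrite ?m0 ?r0 ?two0.
  have [k0 k1] : k != e0 /\ k != e1 by apply/andP; rewrite -negb_or.
  have -> : dmon (a k) x = (w k).@[x 0].
    rewrite /block_partial La // expr0 !mul1r wE /block_cofac blk_a.
    by apply: eq_bigr => q' /andP[/eqP qk _]; rewrite /e qk (negbTE k01).
  by rewrite GE //; ring.
Qed.

End PencilActions.

(** * The variety of a pencil of monomials *)

Section Pencil.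

Variables (K : closedFieldType) (N : nat) (I : finType).
Variables (blk : 'I_N -> I) (L : 'I_N -> nat).
Variables (al ga : I -> K) (e0 e1 : I) (c : I -> 'I_N).
Hypotheses (al0 : al e0 = 1) (ga0 : ga e0 = 0) (al1 : al e1 = 0) (ga1 : ga e1 = 1).
Hypothesis det_neq0 : forall i k, i != k -> al i * ga k - al k * ga i != 0.
Hypothesis charK0 : [pchar K] =i pred0.
Hypothesis L_gt0 : forall q, (0 < L q)%N.
Hypothesis blk_c : forall k, k != e0 -> blk (c k) = k.
Hypothesis Lc : forall k, k != e0 -> k != e1 -> L (c k) = 1%N.
Implicit Types (x y v : 'rV[K]_N) (p q : 'I_N) (i k : I).

Local Notation bmon := (block_mon blk L).
Local Notation cofac := (block_cofac blk L).
Local Notation dmon := (block_partial blk L).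
Local Notation X := (pencil blk L al ga e0 e1).

(** The alternatives reflect the types V1, V3 and V4, in this order. *)
Definition pencil_type : Prop :=
  [\/ forall q, blk q != e0 -> blk q != e1 -> L q = 1%N,
      exists2 p0, blk p0 = e0 & L p0 = 1%N |
      exists p0 p1, [/\ blk p0 = e0, blk p1 = e1, L p0 = 2, L p1 = 2 &
        forall q, (blk q == e0) || (blk q == e1) -> (2 %| L q)%N]].

Hypothesis typeX : pencil_type.

Lemma natr_neq0 n : (0 < n)%N -> n%:R != 0 :> K.
Proof. by move=> n0; move/pcharf0P: charK0 => ->; rewrite -lt0n. Qed.

Lemma e0_neq_e1 : e0 != e1.
Proof. by apply: contraTneq (oner_neq0 K) => e0_neq_e1; rewrite -al0 e0_neq_e1 al1 eqxx. Qed.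

Lemma al_neq0 i : i != e1 -> al i != 0.
Proof. by move/det_neq0; rewrite al1 ga1 mulr1 mul0r subr0. Qed.

Lemma ga_neq0 i : i != e0 -> ga i != 0.
Proof. by move/det_neq0; rewrite al0 ga0 mulr0 mul1r sub0r oppr_eq0. Qed.

Lemma dmon_neq0 p x : bmon (blk p) x != 0 -> dmon p x != 0.
Proof.
rewrite bmon_split mulf_eq0 negb_or expf_eq0 L_gt0 /= => /andP[xp cp].
by rewrite !mulf_neq0 ?expf_neq0 ?natr_neq0.
Qed.

Lemma bmon_eq0P i x : reflect (exists2 p, blk p = i & x 0 p = 0) (bmon i x == 0).
Proof.
apply: (iffP (prodf_eq0 _ _)) => [[p /eqP bp]|[p bp xp]].
  by rewrite expf_eq0 L_gt0 /= => /eqP; exists p.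
by exists p; [apply/eqP | rewrite xp expf_eq0 L_gt0 eqxx].
Qed.

(** Two rows [(al_i, ga_i)] and [(al_k, ga_k)] are linearly independent, so Cramer's rule gives
    [t_{e0} = t_{e1} = 0]. *)
Lemma pencil_bmon0 x i k : X x -> i != k -> bmon i x = 0 -> bmon k x = 0 ->
  forall j, bmon j x = 0.
Proof.
move=> Xx ik; rewrite (Xx i) (Xx k) => ti tk.
have d := det_neq0 ik.
have t0 : bmon e0 x = 0.
  apply: (mulfI d); rewrite mulr0.
  transitivity (ga k * (al i * bmon e0 x + ga i * bmon e1 x)
     - ga i * (al k * bmon e0 x + ga k * bmon e1 x)); first by ring.
  by rewrite ti tk !mulr0 subr0.
have t1 : bmon e1 x = 0.
  apply: (mulfI d); rewrite mulr0.
  transitivity (al i * (al k * bmon e0 x + ga k * bmon e1 x)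
     - al k * (al i * bmon e0 x + ga i * bmon e1 x)); first by ring.
  by rewrite ti tk !mulr0 subr0.
by move=> j; rewrite Xx t0 t1 !mulr0 addr0.
Qed.

(** * Actions moving a prescribed variable of one block *)

Definition fiber_action i x (be : I -> K) (a : I -> 'I_N) p : Prop :=
  exists P c', [/\ Ga_action X P, orbit_tangent x P 0 p != 0,
    bmon i x != 0 -> c' != 0 &
    forall q, dmon q x * orbit_tangent x P 0 q =
      c' * (be (blk q) * (q == (if blk q == i then p else a (blk q)))%:R)].

Lemma elementary_fiber_action i0 i1 i x p (a : I -> 'I_N) (A B : K) :
  let be k := al k * A + ga k * B in
  let a' k := if k == i then p else a k in
  i1 != i0 -> i != i0 -> be i0 = 0 -> be i != 0 -> blk p = i ->
  (forall k, k != i0 -> k != i -> blk (a k) = k) ->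
  (forall k, k != i0 -> k != i1 -> L (a' k) = 1%N) ->
  (forall k, k != i -> bmon k x != 0) ->
  fiber_action i x be a p.
Proof.
move=> be a' i10 ii0 be0 bei bp blk_a La tx.
have blk_a' k : k != i0 -> blk (a' k) = k.
  by move=> ki0; rewrite /a'; case: (eqVneq k i) => [->//|ki]; apply: blk_a.
have [P [PX tanP dP]] := @elementary_action K N I blk L al ga e0 e1 al0 ga0 al1 ga1
   i0 i1 a' A B i10 be0 blk_a' La.
exists P, (\prod_(k | k != i0) dmon (a' k) x); split=> // [|ti|q].
- have -> : p = a' i by rewrite /a' eqxx.
  rewrite tanP // mulf_neq0 //; apply/prodf_neq0 => k /andP[ki0 ki].
  by apply: dmon_neq0; rewrite blk_a' // tx.
- apply/prodf_neq0 => k ki0; apply: dmon_neq0; rewrite blk_a' //.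
  by have [->|/tx] := eqVneq k i.
- rewrite dP; congr (_ * _); rewrite -/(be _) -/(a' _).
  by have [->|_] := eqVneq (blk q) i0; rewrite ?be0 ?mul0r.
Qed.

(** The weights [be] and the variables [a] in the other blocks are common to all [p] of block [i];
    this is what later compares the variables of one block. For [i = e0] and [i = e1] the elementary
    actions with weights [al] and [ga] work, and for the other blocks each type supplies its own
    action. *)
Lemma fiber_actions i x : X x -> (forall k, k != i -> bmon k x != 0) ->
  exists be a, [/\ be i != 0, i = e0 -> be =1 al, i = e1 -> be =1 ga,
    forall k, be k != 0 -> k != i -> blk (a k) = k &
    forall p, blk p = i -> fiber_action i x be a p].
Proof.
move=> Xx tx; have e10 : e1 != e0 by rewrite eq_sym e0_neq_e1.
pose alB k := al k * 1 + ga k * 0; pose gaB k := al k * 0 + ga k * 1.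
have alE : alB =1 al by move=> k; rewrite /alB mulr1 mulr0 addr0.
have gaE : gaB =1 ga by move=> k; rewrite /gaB mulr1 mulr0 add0r.
have [ie0|ie0] := eqVneq i e0.
  exists alB, c; split=> //.
  - by rewrite alE ie0 al0 oner_neq0.
  - by move=> ie1; move: e10; rewrite -ie0 -ie1 eqxx.
  - by move=> k _; rewrite ie0 => /blk_c.
  move=> p bp; apply: (@elementary_fiber_action e1 e0) => //.
  - by rewrite eq_sym.
  - by rewrite ie0 eq_sym.
  - by rewrite -/(alB _) alE.
  - by rewrite -/(alB _) alE ie0 al0 oner_neq0.
  - by move=> k _; rewrite ie0 => /blk_c.
  - by move=> k ke1 ke0; rewrite ie0 (negbTE ke0) Lc.
have [ie1|ie1] := eqVneq i e1.
  exists gaB, c; split=> //.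
  - by rewrite gaE ie1 ga1 oner_neq0.
  - by move=> ie0'; move: ie0; rewrite ie0' eqxx.
  - by move=> k; rewrite gaE => gak _; apply: blk_c; apply: contraNneq gak => ->; rewrite ga0.
  move=> p bp; apply: (@elementary_fiber_action e0 e1) => //.
  - by rewrite -/(gaB _) gaE.
  - by rewrite -/(gaB _) gaE ie1 ga1 oner_neq0.
  - by move=> k /blk_c.
  - by move=> k ke0 ke1; rewrite ie1 (negbTE ke1) Lc.
case: typeX => [L1|[p0 bp0 Lp0]|[p0 [p1 [bp0 bp1 Lp0 Lp1 Leven]]]].
(* All exponents outside [e0] and [e1] are 1, so any [p] of block [i] is admissible; block [e0] is
   left fixed. *)
- exists gaB, c; split=> //.
  + by rewrite gaE ga_neq0.
  + by move=> /eqP; rewrite (negbTE ie0).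
  + by move=> k; rewrite gaE => gak _; apply: blk_c; apply: contraNneq gak => ->; rewrite ga0.
  move=> p bp; apply: (@elementary_fiber_action e0 e1) => //.
  + by rewrite -/(gaB _) gaE.
  + by rewrite -/(gaB _) gaE ga_neq0.
  + by move=> k /blk_c.
  + by move=> k ke0 ke1; case: eqVneq => [ki|_]; rewrite ?Lc // L1 // bp -ki.
(* Here [p0] has exponent 1 in block [e0], so block [i] can be the exceptional one and the exponent
   of [p] is arbitrary; block [e1] is left fixed. *)
- pose a k := if k == e0 then p0 else c k.
  have blk_a k : blk (a k) = k by rewrite /a; case: eqVneq => [->|/blk_c].
  exists alB, a; split=> //.
  + by rewrite alE al_neq0.
  + by move=> /eqP; rewrite (negbTE ie1).
  move=> p bp; apply: (@elementary_fiber_action e1 i) => //.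
  + by rewrite -/(alB _) alE.
  + by rewrite -/(alB _) alE al_neq0.
  + move=> k ke1 ki; rewrite (negbTE ki) /a; case: eqVneq => // ke0.
    by rewrite Lc.
pose a k := if k == e0 then p0 else if k == e1 then p1 else c k.
have blk_a k : blk (a k) = k.
  by rewrite /a; case: (eqVneq k e0) => [->//|ke0]; case: (eqVneq k e1) => [->//|_]; apply: blk_c.
have [r r2] := closed_root (ga i) (ltn0Sn 1).
have [m m2] := closed_root (- al i) (ltn0Sn 1).
have r0 : r != 0 by apply: contra_eq_neq r2 => ->; rewrite expr0n eq_sym ga_neq0.
have m0 : m != 0 by apply: contra_eq_neq m2 => ->; rewrite expr0n eq_sym oppr_eq0 al_neq0.
have two0 : (2 : K) != 0 by rewrite natr_neq0.
pose h0 := x 0 p0 * \prod_(q | (blk q == e0) && (q != p0)) x 0 q ^+ (L q)./2.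
pose h1 := x 0 p1 * \prod_(q | (blk q == e1) && (q != p1)) x 0 q ^+ (L q)./2.
have h00 : h0 != 0.
  have x0 q : blk q = e0 -> x 0 q != 0.
    by move=> bq; apply: (@coord_neq0 K N I blk L L_gt0 x q); rewrite bq tx // eq_sym.
  rewrite mulf_neq0 ?x0 //; apply/prodf_neq0 => q /andP[/eqP bq _].
  by rewrite expf_neq0 ?x0.
(* The square root [m] of [- al i] is chosen up to sign: the weights at [i] for [m] and [- m] differ
   by a multiple of [2 al_i h_0 / m], which is nonzero, so they do not both vanish. *)
suff [m' [m'2 m'0 bei]] : exists m', [/\ m' ^+ 2 = - al i, m' != 0 &
    ga i * (h1 / r) - al i * (h0 / m') != 0].
  pose be k := ga k * (h1 / r) - al k * (h0 / m').
  exists be, a; split=> // [/eqP|/eqP|p bp]; rewrite ?(negbTE ie0) ?(negbTE ie1) //.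
  pose a' k := if k == i then p else a k.
  have blk_a' k : blk (a' k) = k by rewrite /a'; case: eqVneq => [->|].
  have a'0 : a' e0 = p0 by rewrite /a' eq_sym (negbTE ie0) /a eqxx.
  have a'1 : a' e1 = p1 by rewrite /a' eq_sym (negbTE ie1) /a (negbTE e10) eqxx.
  have La' k : k != i -> k != e0 -> k != e1 -> L (a' k) = 1%N.
    by rewrite /a' /a => /negbTE-> k0 k1; rewrite (negbTE k0) (negbTE k1) Lc.
  have [] := @square_action K N I blk L al ga e0 e1 al0 ga0 al1 ga1 L_gt0 i a' r m'
    two0 r2 m'2 r0 m'0 ie0 ie1 blk_a' La' _ _ Leven; rewrite ?a'0 ?a'1 //.
  move=> _ _ [P [R [PX R0 tani dP]]].
  have Rx : R x != 0 by apply: R0.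
  have a'i : a' i = p by rewrite /a' eqxx.
  exists P, (R x * dmon p x); split=> //.
  - by rewrite -a'i tani mulf_neq0.
  - by move=> ti; rewrite mulf_neq0 // dmon_neq0 // bp.
  - by move=> q; rewrite dP a'i.
clearbody h0 h1.
have [y0|y0] := eqVneq (ga i * (h1 / r) - al i * (h0 / m)) 0; last by exists m.
exists (- m); rewrite sqrrN oppr_eq0; split=> //; rewrite invrN !mulrN opprK.
move/eqP: y0; rewrite subr_eq0 => /eqP ->; rewrite -mulr2n -mulr_natl.
by rewrite !mulf_eq0 invr_eq0 !negb_or two0 al_neq0 // h00 m0.
Qed.

(** * Good points and their connection to points with nonzero coordinates *)

Definition simple_block i x : Prop :=
  exists p, [/\ blk p = i, x 0 p = 0 & dmon p x != 0].

(* These turn out to be the regular points of X. *)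
Definition good x : Prop := (exists k, bmon k x != 0) \/
  exists i0 i1, i1 != i0 /\ forall k, k != i0 -> k != i1 -> simple_block k x.

(** At [T_p = 0] the partial derivative contains [0 ^ (L p - 1)], which is nonzero only for
    [L p = 1]. A simple block thus has a single zero, of exponent 1. *)
Lemma simple_zero p x : x 0 p = 0 -> dmon p x != 0 -> L p = 1%N /\ cofac p x != 0.
Proof.
rewrite /dmon => ->; case: (L p) (L_gt0 p) => [|[|l]] // _.
  by rewrite expr0 !mul1r.
by rewrite expr0n mulr0 mul0r eqxx.
Qed.

Lemma good_move x q : X x -> good x -> x 0 q = 0 ->
  exists P p, [/\ Ga_action X P, x 0 p = 0 & orbit_tangent x P 0 p != 0].
Proof.
move=> Xx gx xq; have tq : bmon (blk q) x = 0 by apply/eqP/bmon_eq0P; exists q.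
have [[k tk]|t0] := classic (exists k, bmon k x != 0).
  have tx k' : k' != blk q -> bmon k' x != 0.
    by move=> k'q; apply: contraNneq tk => tk'; apply/eqP/(pencil_bmon0 Xx k'q).
  have [be [a [_ _ _ _ /(_ q erefl) [P [_ [PX Pq _ _]]]]]] := fiber_actions Xx tx.
  by exists P, q.
have {}t0 k : bmon k x = 0.
  by apply/eqP/negPn/negP => tk; apply: t0; exists k.
case: gx => [[k]|[i0 [i1 [i10 simp]]]]; first by rewrite t0 eqxx.
have [p bp xp] := bmon_eq0P i1 x (introT eqP (t0 i1)).
have [a aP] : exists a : I -> 'I_N, forall k, k != i0 -> k != i1 ->
    [/\ blk (a k) = k, x 0 (a k) = 0 & dmon (a k) x != 0].
  apply: (@fin_all_exists I (fun _ => 'I_N) (fun k q' => k != i0 -> k != i1 ->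
    [/\ blk q' = k, x 0 q' = 0 & dmon q' x != 0])) => k.
  have [->|ki0] := eqVneq k i0; first by exists p => /eqP.
  have [->|ki1] := eqVneq k i1; first by exists p => _ /eqP.
  by have [y ?] := simp k ki0 ki1; exists y.
pose a' k := if k == i1 then p else a k.
have a'p : a' i1 = p by rewrite /a' eqxx.
have aE k : k != i1 -> a' k = a k by rewrite /a' => /negbTE ->.
have blk_a' k : k != i0 -> blk (a' k) = k.
  by have [->|k1] := eqVneq k i1; rewrite ?a'p // aE // => k0; have [] := aP k k0 k1.
have La' k : k != i0 -> k != i1 -> L (a' k) = 1%N.
  by move=> k0 k1; rewrite aE //; have [_ z d] := aP k k0 k1; have [] := simple_zero z d.
(* The weights [al k * ga i0 - ga k * al i0] vanish at [i0] and, by [det_neq0], nowhere else. *)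
have be0 : al i0 * ga i0 + ga i0 * - al i0 = 0 by ring.
have [P [PX tanP _]] := @elementary_action K N I blk L al ga e0 e1 al0 ga0 al1 ga1
   i0 i1 a' (ga i0) (- al i0) i10 be0 blk_a' La'.
exists P, p; split=> //; rewrite -a'p tanP // mulf_neq0 //.
  rewrite mulrN [ga i1 * _]mulrC; exact: det_neq0.
apply/prodf_neq0 => k /andP[k0 k1]; rewrite aE //.
by have [] := aP k k0 k1.
Qed.

(** If all block monomials of [y] vanish, each block still has a zero, and in a simple block of [x]
    it must be the same single one. *)
Lemma good_mono x y : (forall p, y 0 p = 0 -> x 0 p = 0) -> good x -> good y.
Proof.
move=> yx gx; have [ty|ty] := classic (exists k, bmon k y != 0); first by left.
have {}ty k : bmon k y = 0.
  by apply/eqP/negPn/negP => tk; apply: ty; exists k.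
have tx k : bmon k x = 0.
  have [p bp yp] := bmon_eq0P k y (introT eqP (ty k)).
  by apply/eqP/bmon_eq0P; exists p => //; apply: yx.
case: gx => [[k]|[i0 [i1 [i10 simp]]]]; first by rewrite tx eqxx.
right; exists i0, i1; split=> // k k0 k1.
have [p [bp xp dp]] := simp k k0 k1; have [Lp cp] := simple_zero xp dp.
have x0 q : blk q = blk p -> q != p -> x 0 q != 0.
  move=> bq qp; move: cp; rewrite /block_cofac => /prodf_neq0/(_ q).
  by rewrite bq eqxx qp => /(_ isT); rewrite expf_eq0 L_gt0.
have [q bq yq] := bmon_eq0P k y (introT eqP (ty k)).
have qp : q = p.
  by apply: contraTeq isT => qp; have /eqP[] := x0 q (etrans bq (esym bp)) qp; apply: yx.
exists p; split=> //; first by rewrite -qp.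
rewrite /block_partial Lp expr0 !mul1r; apply/prodf_neq0 => q' /andP[/eqP bq' q'p].
by rewrite expf_neq0 //; apply: contraNneq (x0 q' bq' q'p) => /yx ->.
Qed.

Definition zeros x := [set p | x 0 p == 0].

(** With [h] the product of the coordinates that are not identically zero along the orbit, no new
    zero appears off the roots of [h], while the coordinate moved by [good_move] becomes nonzero. *)
Lemma good_step x q : X x -> good x -> x 0 q = 0 ->
  exists P (h : {poly K}), [/\ Ga_action X P, h != 0 & forall s, h.[s] != 0 ->
    good (Ga_act P s x) /\ (#|zeros (Ga_act P s x)| < #|zeros x|)%N].
Proof.
move=> Xx gx xq; have [P [p [PX xp tp]]] := good_move Xx gx xq.
have [_ P0 _] := PX.
pose h := \prod_(q' | gcurve P x q' != 0) gcurve P x q'.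
have nz q' : gcurve P x q' = 0 -> x 0 q' = 0.
  by move=> z; rewrite -(P0 x Xx) -horner_gcurve z horner0.
exists P, h; split=> //; first exact/prodf_neq0.
move=> s; rewrite horner_prod => /prodf_neq0 hs.
have yx q' : Ga_act P s x 0 q' = 0 -> gcurve P x q' = 0.
  move=> yq; apply/eqP/negPn/negP => /hs.
  by rewrite horner_gcurve yq eqxx.
split; first by apply: good_mono gx => q' /yx/nz.
apply/proper_card/properP; split.
  by apply/subsetP => q'; rewrite !inE => /eqP/yx/nz ->.
exists p; rewrite !inE ?xp //; apply: contraNneq tp => /yx z.
by rewrite -velocity_gcurve mxE z derivC horner0.
Qed.

(** Induction on the number of zero coordinates; both spanning and the vanishing of a polynomial are
    propagated this way. *)
Lemma good_ind (C : 'rV[K]_N -> Prop) :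
  (forall x, X x -> (forall p, x 0 p != 0) -> C x) ->
  (forall x P (h : {poly K}), X x -> Ga_action X P -> h != 0 ->
    (forall s, h.[s] != 0 -> C (Ga_act P s x)) -> C x) ->
  forall x, X x -> good x -> C x.
Proof.
move=> C0 CS x; have [n] := ubnP #|zeros x|; elim: n x => // n IH x xn Xx gx.
have [z0|[q]] := set_0Vmem (zeros x).
  by apply: C0 => // p; apply/negP => xp; move: (in_set0 p); rewrite -z0 inE xp.
rewrite inE => /eqP xq; have [P [h [PX h0 hP]]] := good_step Xx gx xq.
apply: (CS x P h) => // s /hP[gy ys]; have [XP _ _] := PX.
by apply: IH => //; [apply: leq_trans ys _ | apply: XP].
Qed.

(** * Spanning at points with nonzero coordinates *)

Definition block_diff i x v : K := \sum_(q | blk q == i) dmon q x * v 0 q.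

Lemma tangent_pencil x v i : tangent X x v ->
  block_diff i x v = al i * block_diff e0 x v + ga i * block_diff e1 x v.
Proof.
move=> Tv; pose pm i := pmon K (fun q => blk q == i) L.
have pmE j y : (pm j).@[y 0] = bmon j y by rewrite meval_pmon.
have dE j : \sum_q ((pm j)^`M(q)).@[x 0] * v 0 q = block_diff j x v.
  rewrite /block_diff [RHS]big_mkcond; apply: eq_bigr => q _; rewrite deriv_pmon.
  by case: eqP => [<-|_] //; rewrite mul0r.
pose f := pm i - (al i *: pm e0 + ga i *: pm e1).
have f0 y : X y -> f.@[y 0] = 0.
  by move=> Xy; rewrite mevalB mevalD !mevalZ !pmE Xy subrr.
have /eqP := Tv f f0; rewrite (eq_bigr (fun q => ((pm i)^`M(q)).@[x 0] * v 0 q -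
    (al i * (((pm e0)^`M(q)).@[x 0] * v 0 q) + ga i * (((pm e1)^`M(q)).@[x 0] * v 0 q)))).
  by rewrite sumrB big_split -!mulr_sumr !dE subr_eq0 => /eqP.
move=> q _; rewrite mderivB mderivD !mderivZ mevalB mevalD !mevalZ.
by ring.
Qed.

Lemma sum_section (F : I -> K) (b : I -> 'I_N) :
  (forall k, F k != 0 -> blk (b k) = k) ->
  \sum_q F (blk q) * (q == b (blk q))%:R = \sum_k F k.
Proof.
move=> bF; rewrite (partition_big blk predT) //=; apply: eq_bigr => k _.
under eq_bigr => q /eqP -> do [].
have [F0|/bF bk] := eqVneq (F k) 0.
  by rewrite F0 big1 // => q _; rewrite mul0r.
rewrite (bigD1 (b k)) ?bk //= eqxx mulr1 big1 ?addr0 // => q /andP[_ /negbTE ->].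
by rewrite mulr0.
Qed.

(** By duality: a linear form [w] killing the tangent vectors of all fiber actions must kill [v].
    Dividing [w] by the partial derivatives gives [ka], which is constant on blocks, so [w] is a
    combination [sum_i kb_i dt_i]. The actions for [e0] and [e1] give [sum_i kb_i al_i = 0] and
    [sum_i kb_i ga_i = 0], and the pencil relations between the [dt_i] conclude. *)
Lemma spanned_torus x : X x -> (forall p, x 0 p != 0) -> spanned X x.
Proof.
move=> Xx x0; have tx i : bmon i x != 0.
  by apply/negP => /bmon_eq0P[p _ xp]; move: (x0 p); rewrite xp eqxx.
have dx p : dmon p x != 0 by apply: dmon_neq0.
have [ba baP] := @fin_all_exists I (fun _ => (I -> K) * (I -> 'I_N))%type
  (fun i d => [/\ d.1 i != 0, i = e0 -> d.1 =1 al, i = e1 -> d.1 =1 ga,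
    forall k, d.1 k != 0 -> k != i -> blk (d.2 k) = k &
    forall p, blk p = i -> fiber_action i x d.1 d.2 p])
  (fun i => let: ex_intro be (ex_intro a H) := fiber_actions Xx (fun k _ => tx k) in
     ex_intro _ (be, a) H).
pose be i := (ba i).1; pose a i := (ba i).2.
pose sec p k := if k == blk p then p else a (blk p) k.
pose good_act p (P : Ga_map K N) := exists c', [/\ Ga_action X P, c' != 0 &
    forall q, dmon q x * orbit_tangent x P 0 q =
      c' * (be (blk p) (blk q) * (q == sec p (blk q))%:R)].
have [P PP] : exists P : 'I_N -> Ga_map K N, forall p, good_act p (P p).
  apply: (@fin_all_exists 'I_N (fun _ => Ga_map K N) good_act) => p.
  have [_ _ _ _ /(_ p erefl)[P [c' [PX _ c0 dP]]]] := baP (blk p).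
  by exists P, c'; split=> //; apply: c0.
exists [seq P p | p <- enum 'I_N]; split=> [_ /mapP[p _ ->]|v Tv].
  by have [c' []] := PP p.
pose M : 'M[K]_N := \matrix_p orbit_tangent x (P p).
suff /submxP[D ->] : (v <= M)%MS.
  rewrite mulmx_sum_row; apply: memv_suml => p _; apply: memvZ; apply: memv_span.
  by rewrite rowK -map_comp; apply/mapP; exists p; rewrite ?mem_enum.
rewrite submxE; apply/eqP/matrixP => z0 j; rewrite ord1 !mxE {z0}.
(* Each column of the cokernel is a linear form vanishing on all rows of [M]. *)
pose w q := cokermx M q j; pose ka q := w q / dmon q x.
have Mw p : \sum_q orbit_tangent x (P p) 0 q * w q = 0.
  have /matrixP/(_ p j) := mulmx_coker M; rewrite !mxE => Mc.
  by rewrite -[RHS]Mc; apply: eq_bigr => q _; rewrite [M p q]mxE.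
have ka_rel p : \sum_q be (blk p) (blk q) * (q == sec p (blk q))%:R * ka q = 0.
  have [c' [_ c0 dP]] := PP p; apply: (mulfI c0); rewrite mulr0 -[RHS](Mw p) mulr_sumr.
  apply: eq_bigr => q _; rewrite mulrA -dP /ka; field; exact: dx.
pose S i := \sum_(q | blk q != i) be i (blk q) * (q == a i (blk q))%:R * ka q.
pose kb i := - S i / be i i.
have be0 i : be i i != 0 by have [] := baP i.
(* In the relation for [p], only the term at [p] itself depends on [p] inside its block. *)
have kaE p : ka p = kb (blk p).
  apply: (mulfI (be0 (blk p))); rewrite /kb [RHS]mulrC divfK //.
  apply/eqP; rewrite -addr_eq0; apply/eqP; rewrite -[RHS](ka_rel p).
  rewrite [RHS](bigID (fun q => blk q != blk p)) /= addrC; congr (_ + _).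
    rewrite (bigD1 p) /=; last by rewrite negbK.
    rewrite /sec !eqxx mulr1 big1 ?addr0 // => q /andP[/negPn/eqP bq /negbTE qp].
    by rewrite bq eqxx qp mulr0 mul0r.
  by rewrite /S; apply: eq_bigr => q /negbTE bq; rewrite /sec bq.
have kb_rel p : \sum_k be (blk p) k * kb k = 0.
  pose F k := be (blk p) k * kb k.
  have <- : \sum_q F (blk q) * (q == sec p (blk q))%:R = \sum_k F k.
    apply: sum_section => k; rewrite /F mulf_eq0 negb_or /sec => /andP[bk _].
    by case: eqVneq => // kp; have [_ _ _ ->] := baP (blk p).
  by rewrite -[RHS](ka_rel p); apply: eq_bigr => q _; rewrite kaE /F; ring.
transitivity (\sum_i kb i * block_diff i x v).
  rewrite (partition_big blk predT) //=; apply: eq_bigr => i _.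
  rewrite mulr_sumr; apply: eq_bigr => q /eqP <-; rewrite -kaE /ka -/(w q).
  by field; exact: dx.
under eq_bigr => i _ do rewrite (tangent_pencil i Tv) mulrDr !mulrA.
rewrite big_split -!mulr_suml /=.
(* An empty block, possible for [e0], yields no relation, but its differential is then an empty
   sum. *)
have diff0 e (g : I -> K) : (forall p, blk p = e -> be e =1 g) ->
    (\sum_i kb i * g i) * block_diff e x v = 0.
  move=> beg; have [p /eqP bp|none] := pickP (fun p => blk p == e).
    rewrite (_ : \sum_i _ = 0) ?mul0r // -[RHS](kb_rel p).
    by apply: eq_bigr => k _; rewrite bp (beg p bp) mulrC.
  by rewrite [block_diff e x v]big_pred0 ?mulr0.
rewrite (diff0 e0 al) => [|p bp]; last by have [_ H _ _ _] := baP e0; apply: H.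
by rewrite (diff0 e1 ga) ?addr0 // => p bp; have [_ _ H _ _] := baP e1; apply: H.
Qed.

Lemma spanned_good x : X x -> good x -> spanned X x.
Proof.
apply: good_ind => {}x; first exact: spanned_torus.
move=> P h Xx PX /poly_nonroot[s hs] sp.
exact: (@spanned_Ga_act K N X P s x PX Xx (sp s hs)).
Qed.

(** * Density of the points with nonzero coordinates *)

Lemma generic_member : exists t, forall i, al i + ga i * t != 0.
Proof.
(* Here [t] stands for the ratio [t_{e1} / t_{e0}]; at a non-root of [h] every block monomial is
   nonzero. *)
pose h : {poly K} := \prod_i ((al i)%:P + (ga i)%:P * 'X).
have [|t] := @poly_nonroot K h.
  apply/prodf_neq0 => i _; have [->|i1] := eqVneq i e1.
    by rewrite al1 ga1 add0r mul1r polyX_eq0.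
  apply: contraNneq (al_neq0 i1) => /(congr1 (fun P => P.[0])).
  by rewrite !hornerE ?mulr0 ?addr0 => ->.
rewrite horner_prod => /prodf_neq0 ht; exists t => i.
by have := ht i isT; rewrite !hornerE.
Qed.

Lemma torus_point : exists x, X x /\ forall p, x 0 p != 0.
Proof.
have [t ht] := generic_member.
have [r rt] := closed_root t (L_gt0 (c e1)).
have e10 : e1 != e0 by rewrite eq_sym e0_neq_e1.
have t0 : t != 0 by have := ht e1; rewrite al1 ga1 add0r mul1r.
pose x : 'rV[K]_N := \row_p (if (blk p != e0) && (p == c (blk p)) then
  if blk p == e1 then r else al (blk p) + ga (blk p) * t else 1).
have xc k : k != e0 -> x 0 (c k) = if k == e1 then r else al k + ga k * t.
  by move=> k0; rewrite mxE blk_c // k0 eqxx.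
have x1 p : p != c (blk p) -> x 0 p = 1.
  by move=> pc; rewrite mxE (negbTE pc) andbF.
have tx k : bmon k x = al k * 1 + ga k * t.
  have [->|k0] := eqVneq k e0.
    rewrite al0 ga0 mulr1 mul0r addr0; apply: big1 => p /eqP bp.
    by rewrite mxE bp eqxx /= expr1n.
  rewrite -{1}(blk_c k0) bmon_split /block_cofac big1 ?mulr1 => [|p /andP[/eqP]]; last first.
    by rewrite blk_c // => bp pc; rewrite x1 ?expr1n // bp.
  rewrite xc //; have [->|k1] := eqVneq k e1; first by rewrite rt al1 ga1 add0r mul1r.
  by rewrite Lc.
exists x; split=> [k|p].
  by rewrite !tx al0 ga0 al1 ga1 !(mul0r, mul1r, add0r, addr0).
rewrite mxE; case: ifP => _; last exact: oner_neq0.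
case: ifP => _; last exact: ht.
by apply: contraNneq t0 => r0; rewrite -rt r0 expf_eq0 L_gt0 eqxx.
Qed.

(* When all block monomials vanish at x, replacing the zero coordinates of block i
   by kappa_i s^(D/e_i), with e_i their total exponent, makes each block monomial
   equal to (al_i + ga_i t) s^D. *)
Lemma vertex_curve x : (forall i, bmon i x = 0) -> exists g : 'I_N -> {poly K},
  [/\ at_time g 0 = x, forall s, X (at_time g s) & forall p, (g p).[1] != 0].
Proof.
move=> tx; have [t ht] := generic_member.
pose e i := (\sum_(q | (blk q == i) && (x 0%R q == 0%R)) L q)%N.
have e_gt0 i : (0 < e i)%N.
  have [p bp xp] := bmon_eq0P i x (introT eqP (tx i)).
  by rewrite /e (bigD1 p) ?bp ?xp ?eqxx // addn_gt0 L_gt0.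
pose C i := \prod_(q | (blk q == i) && (x 0 q != 0)) x 0 q ^+ L q.
have C0 i : C i != 0.
  by apply/prodf_neq0 => q /andP[_ xq]; rewrite expf_neq0.
have [ka kaP] : exists ka : I -> K, forall i, ka i ^+ e i = (al i + ga i * t) / C i.
  apply: (@fin_all_exists I (fun _ => K) (fun i r => r ^+ e i = (al i + ga i * t) / C i)).
  by move=> i; apply: closed_root.
have ka0 i : ka i != 0.
  have : ka i ^+ e i != 0 by rewrite kaP mulf_neq0 ?invr_neq0.
  by rewrite expf_eq0 e_gt0.
pose D := (\prod_i e i)%N.
have De i : (e i %| D)%N by rewrite /D (bigD1 i) //= dvdn_mulr.
have D_gt0 : (0 < D)%N by rewrite prodn_gt0.
pose g p : {poly K} := if x 0 p == 0 then ka (blk p) *: 'X^(D %/ e (blk p)) else (x 0 p)%:P.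
have tg i s : bmon i (at_time g s) = (al i + ga i * t) * s ^+ D.
  rewrite /block_mon (bigID (fun q => x 0 q == 0)) /=.
  rewrite (eq_bigr (fun q => (ka i * s ^+ (D %/ e i)) ^+ L q)); last first.
    by move=> q /andP[/eqP bq xq]; rewrite mxE /g xq hornerZ hornerXn bq.
  rewrite prodrXr -/(e i) [X in _ * X](_ : _ = C i); last first.
    by apply: eq_bigr => q /andP[_ /negbTE xq]; rewrite mxE /g xq hornerC.
  by rewrite exprMn -exprM divnK // kaP mulrAC divfK.
exists g; split=> [|s i|p].
- apply/rowP => p; rewrite mxE /g; case: eqP => [->|_]; last by rewrite hornerC.
  by rewrite hornerZ hornerXn expr0n gtn_eqF ?mulr0 // divn_gt0 // dvdn_leq.
- by rewrite !tg al0 ga0 al1 ga1 mul0r addr0 mul1r add0r mul1r mulrDl mulrA.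
- rewrite /g; case: (eqVneq (x 0 p) 0) => [_|xp]; last by rewrite hornerC.
  by rewrite hornerZ hornerXn expr1n mulr1.
Qed.

(** Good points are reached by [good_ind]. At any other point all block monomials vanish, and
    [vertex_curve] joins it inside [X] to points with nonzero coordinates. *)
Lemma torus_dense f : (forall x, X x -> (forall p, x 0 p != 0) -> f.@[x 0] = 0) ->
  forall x, X x -> f.@[x 0] = 0.
Proof.
move=> ft x Xx; have [gx|ngx] := classic (good x).
  apply: (good_ind (C := fun x => f.@[x 0] = 0)) gx => // {}x P h {}Xx [XP P0 _] h0 fh.
  rewrite -(P0 x Xx) -at_time_gcurve; apply: (curve_vanish h0) => s hs.
  by rewrite at_time_gcurve fh.
have tx i : bmon i x = 0.
  by apply/eqP/negPn/negP => ti; apply: ngx; left; exists i.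
have [g [<- Xg g1]] := vertex_curve tx.
apply: (@curve_vanish _ _ _ _ (\prod_p g p)) => [|s].
  by apply/prodf_neq0 => p _; apply: contraNneq (g1 p) => ->; rewrite horner0.
rewrite horner_prod => /prodf_neq0 gs; apply: ft => // p.
by rewrite mxE gs.
Qed.

Definition high i := (i != e0) && (i != e1).

(** * The variety as a graph, and its irreducibility *)

Definition free p := ~~ high (blk p) || (p != c (blk p)).
Definition nfree := #|[set p | free p]|.
Definition fvar (j : 'I_nfree) : 'I_N := enum_val j.
Definition fcoord x : 'I_nfree -> K := fun j => x 0 (fvar j).
Definition fX p : {mpoly K[nfree]} := if [pick j | fvar j == p] is Some j then 'X_j else 1.

Lemma fX_fvar j : fX (fvar j) = 'X_j.
Proof.
rewrite /fX; case: pickP => [j' /eqP/enum_val_inj->//|/(_ j)].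
by rewrite eqxx.
Qed.

Lemma fvar_surj p : free p -> exists j, fvar j = p.
Proof.
move=> fp; have pA : p \in [set p | free p] by rewrite inE.
by exists (enum_rank_in pA p); rewrite /fvar enum_rankK_in.
Qed.

Lemma meval_fX x p : free p -> (fX p).@[fcoord x] = x 0 p.
Proof. by move=> /fvar_surj[j <-]; rewrite fX_fvar mevalXU. Qed.

Definition fpmon (A : pred 'I_N) : {mpoly K[nfree]} := \prod_(q | A q) fX q ^+ L q.
Definition hatm i := fpmon (fun q => (blk q == i) && (q != c i)).
Definition blockm i := fpmon (fun q => blk q == i).
Definition den := \prod_(i | high i) hatm i.
Definition num p : {mpoly K[nfree]} :=
  if free p then den * fX p
  else (al (blk p) *: blockm e0 + ga (blk p) *: blockm e1) *
       \prod_(i | high i && (i != blk p)) hatm i.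

Lemma meval_fpmon (A : pred 'I_N) z :
  (fpmon A).@[z] = \prod_(q | A q) (fX q).@[z] ^+ L q.
Proof. by rewrite rmorph_prod; apply: eq_bigr => q _; rewrite rmorphXn. Qed.

Lemma meval_fpmon_fcoord (A : pred 'I_N) x : (forall q, A q -> free q) ->
  (fpmon A).@[fcoord x] = \prod_(q | A q) x 0 q ^+ L q.
Proof.
by move=> Af; rewrite meval_fpmon; apply: eq_bigr => q /Af fq; rewrite meval_fX.
Qed.

Lemma free_low q : ~~ high (blk q) -> free q.
Proof. by rewrite /free => ->. Qed.

Lemma free_hat i q : (blk q == i) && (q != c i) -> free q.
Proof. by case/andP=> /eqP <- qc; rewrite /free qc orbT. Qed.

Lemma low0 : ~~ high e0. Proof. by rewrite /high eqxx. Qed.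
Lemma low1 : ~~ high e1. Proof. by rewrite /high eqxx andbF. Qed.

Lemma meval_blockm i x : ~~ high i -> (blockm i).@[fcoord x] = bmon i x.
Proof.
by move=> hi; apply: meval_fpmon_fcoord => q /eqP bq; apply: free_low; rewrite bq.
Qed.

Lemma not_free p : ~~ free p -> high (blk p) /\ p = c (blk p).
Proof. by rewrite negb_or negbK => /andP[hp /negPn/eqP]. Qed.

Lemma bmon_high i x : high i ->
  bmon i x = x 0 (c i) * \prod_(q | (blk q == i) && (q != c i)) x 0 q ^+ L q.
Proof.
case/andP=> i0 i1; rewrite -{1}(blk_c i0) bmon_split Lc // expr1; congr (_ * _).
by apply: eq_bigl => q; rewrite blk_c.
Qed.

Lemma num_den x p : X x -> (num p).@[fcoord x] = den.@[fcoord x] * x 0 p.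
Proof.
move=> Xx; rewrite /num; case: ifPn => [fp|/not_free[hp pc]].
  by rewrite mevalM meval_fX.
rewrite mevalM mevalD !mevalZ !meval_blockm ?low0 ?low1 // -Xx bmon_high // -pc.
rewrite /den [in RHS](bigD1 (blk p)) //= mevalM meval_fpmon_fcoord => [|q]; last first.
  exact: free_hat.
by rewrite -pc; ring.
Qed.

Lemma den_torus x : (forall p, x 0 p != 0) -> den.@[fcoord x] != 0.
Proof.
move=> x0; rewrite rmorph_prod; apply/prodf_neq0 => i hi /=.
rewrite meval_fpmon_fcoord; last exact: free_hat.
by apply/prodf_neq0 => q _; rewrite expf_neq0.
Qed.

Lemma clear_den f : exists M G, forall x, X x ->
  G.@[fcoord x] = den.@[fcoord x] ^+ M * f.@[x 0].
Proof.
elim/mpoly_ring_ind: f => [b|i|f g [M [F FE]] [M' [G GE]]|f g [M [F FE]] [M' [G GE]]].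
- by exists 0%N, b%:MP => x _; rewrite expr0 mul1r !mevalC.
- by exists 1%N, (num i) => x Xx; rewrite expr1 mevalXU num_den.
- exists (M + M')%N, (F * den ^+ M' + G * den ^+ M) => x Xx.
  by rewrite mevalD !mevalM !rmorphXn /= FE // GE // mevalD exprD; ring.
- exists (M + M')%N, (F * G) => x Xx.
  by rewrite !mevalM FE // GE // exprD; ring.
Qed.

Lemma graph_section z : den.@[z] != 0 -> exists x, X x /\ fcoord x =1 z.
Proof.
move=> d0; pose x : 'rV[K]_N := \row_p ((num p).@[z] / den.@[z]).
have xf p : free p -> x 0 p = (fX p).@[z].
  by move=> fp; rewrite mxE /num fp mevalM mulrC mulKf.
have xz : fcoord x =1 z.
  move=> j; rewrite /fcoord xf ?fX_fvar ?mevalXU //.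
  by have := enum_valP j; rewrite inE.
exists x; split=> // i; have [hi|li] := boolP (high i); last first.
  move: li; rewrite negb_and !negbK => /orP[/eqP->|/eqP->].
    by rewrite al0 ga0 mul1r mul0r addr0.
  by rewrite al1 ga1 mul1r mul0r add0r.
have [i0 i1] : i != e0 /\ i != e1 by apply/andP.
have lowE e : ~~ high e -> (blockm e).@[z] = bmon e x.
  by move=> le; rewrite -meval_blockm //; apply: meval_eq => j; rewrite xz.
have denE : den.@[z] = \prod_(q | (blk q == i) && (q != c i)) x 0 q ^+ L q *
    (\prod_(k | high k && (k != i)) hatm k).@[z].
  rewrite /den (bigD1 i) //= mevalM; congr (_ * _).
  rewrite -meval_fpmon_fcoord; last exact: free_hat.
  by apply: meval_eq => j; rewrite xz.
rewrite bmon_high // {1}mxE /num /free blk_c // hi eqxx /= mevalM mevalD !mevalZ !lowE ?low0 ?low1 //.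
by move: d0; rewrite denE mulf_eq0 negb_or => /andP[h0 r0]; field; rewrite h0 r0.
Qed.

(** If neither factor vanishes on [X], density gives points [x] and [y] with [f(x)], [g(y)] and both
    denominators nonzero. On the line joining their free coordinates, [F G den] is a nonzero
    polynomial; a non-root lifts to a point of [X] where [f g] is nonzero. *)
Lemma vanish_prod f g : (forall x, X x -> f.@[x 0] * g.@[x 0] = 0) ->
  (forall x, X x -> f.@[x 0] = 0) \/ (forall x, X x -> g.@[x 0] = 0).
Proof.
move=> fg; have wit (f' : {mpoly K[N]}) : ~ (forall x, X x -> f'.@[x 0] = 0) ->
    exists x, [/\ X x, f'.@[x 0] != 0 & den.@[fcoord x] != 0].
  move=> nf; apply: NNPP => nx; apply: nf; apply: torus_dense => x Xx x0.
  apply/eqP/negPn/negP => fx; apply: nx; exists x; split=> //; exact: den_torus.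
have [|/wit[x [Xx fx dx]]] := classic (forall x, X x -> f.@[x 0] = 0); first by left.
have [|/wit[y [Xy gy dy]]] := classic (forall x, X x -> g.@[x 0] = 0); first by right.
have [M [F FE]] := clear_den f; have [M' [G GE]] := clear_den g.
pose line j : {poly K} := (fcoord x j)%:P + (fcoord y j - fcoord x j)%:P * 'X.
have l0 : (fun j => (line j).[0]) =1 fcoord x.
  by move=> j; rewrite hornerD hornerM hornerX !hornerC mulr0 addr0.
have l1 : (fun j => (line j).[1]) =1 fcoord y.
  by move=> j; rewrite hornerD hornerM hornerX !hornerC mulr1 addrC subrK.
have nz0 f' : f'.@[fcoord x] != 0 -> mcurve line f' != 0.
  by rewrite -(meval_eq f' l0) -horner_mcurve; apply: contraNneq => ->; rewrite horner0.
have nz1 f' : f'.@[fcoord y] != 0 -> mcurve line f' != 0.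
  by rewrite -(meval_eq f' l1) -horner_mcurve; apply: contraNneq => ->; rewrite horner0.
have FGD : mcurve line F * mcurve line G * mcurve line den != 0.
  apply: mulf_neq0; last exact: nz0.
  by apply: mulf_neq0; [apply: nz0; rewrite FE | apply: nz1; rewrite GE];
     rewrite ?mulf_eq0 ?expf_eq0 // negb_or ?fx ?gy ?(negbTE dx) ?(negbTE dy) andbF.
have [s] := poly_nonroot FGD; rewrite !hornerM !mulf_eq0 !negb_or !horner_mcurve.
case/andP=> /andP[Fs Gs] ds; have [w [Xw wE]] := graph_section ds.
have := fg w Xw; move: Fs Gs.
rewrite -(meval_eq F wE) -(meval_eq G wE) FE // GE // !mulf_eq0 !negb_or.
by move=> /andP[_ fw] /andP[_ gw] /eqP; rewrite mulf_eq0 (negbTE fw) (negbTE gw).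
Qed.

Lemma irreducible_pencil : irreducible X.
Proof.
split=> [|Y Z [S YS] [S' ZS] XYZ]; first by have [x [Xx _]] := torus_point; exists x.
have [|nY] := classic (subvar X Y); first by left.
have [|nZ] := classic (subvar X Z); first by right.
have [x [Xx /YS nYx]] : exists x, X x /\ ~ Y x.
  by apply: NNPP => H; apply: nY => w Xw; apply: NNPP => Yw; apply: H; exists w.
have [y [Xy /ZS nZy]] : exists x, X x /\ ~ Z x.
  by apply: NNPP => H; apply: nZ => w Xw; apply: NNPP => Zw; apply: H; exists w.
have [f [Sf fx]] : exists f, S f /\ f.@[x 0] <> 0.
  by apply: NNPP => H; apply: nYx => h Sh; apply: NNPP => hx; apply: H; exists h.
have [g [Sg gy]] : exists f, S' f /\ f.@[y 0] <> 0.
  by apply: NNPP => H; apply: nZy => h Sh; apply: NNPP => hx; apply: H; exists h.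
have [|/(_ x Xx)//|/(_ y Xy)//] := @vanish_prod f g.
by move=> z /XYZ[/YS/(_ f Sf)->|/ZS/(_ g Sg)->]; rewrite ?mul0r ?mulr0.
Qed.

Lemma zclosed_pencil : zclosed X.
Proof.
pose pm i := pmon K (fun q => blk q == i) L.
have pmE j (y : 'rV[K]_N) : (pm j).@[y 0] = bmon j y by rewrite meval_pmon.
exists (fun f => exists i, f = pm i - (al i *: pm e0 + ga i *: pm e1)) => x.
split=> [Xx f [i ->]|H i]; first by rewrite mevalB mevalD !mevalZ !pmE Xx subrr.
have := H _ (ex_intro _ i erefl).
by rewrite mevalB mevalD !mevalZ !pmE => /eqP; rewrite subr_eq0 => /eqP.
Qed.

(** * Dimension bounds *)

Lemma nfree_bound : (nfree + (#|I| - 2) <= N)%N.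
Proof.
have -> : (#|I| - 2 = #|[set i | high i]|)%N.
  have -> : [set i | high i] = ~: [set e0; e1].
    by apply/setP => i; rewrite !inE negb_or.
  by rewrite cardsCs setCK cards2 e0_neq_e1.
rewrite -(@card_in_imset _ _ c) => [|i k]; last first.
  by rewrite !inE => /andP[i0 _] /andP[k0 _] /(congr1 blk); rewrite !blk_c.
rewrite -[N in (_ <= N)%N]card_ord -(cardsC [set p | free p]) leq_add2l.
apply/subset_leq_card/subsetP => p /imsetP[i]; rewrite inE => hi ->.
have [i0 _] := andP hi.
by rewrite !inE /free blk_c // hi eqxx.
Qed.

(** Where [den] is nonzero, functions on [X] are fractions in [nfree] parameters, so
    [poly_dependence] gives a relation between more than [nfree] of them; by density it holds on all
    of [X]. *)
Lemma alg_indep_bound r (f : 'I_r -> {mpoly K[N]}) : alg_indep X f -> (r <= nfree)%N.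
Proof.
move=> indf; rewrite leqNgt; apply/negP => r_gt.
have [MF MFE] : exists MF : 'I_r -> nat * {mpoly K[nfree]}, forall j x, X x ->
    (MF j).2.@[fcoord x] = den.@[fcoord x] ^+ (MF j).1 * (f j).@[x 0].
  pose Q j (mf : nat * {mpoly K[nfree]}) := forall x, X x ->
    mf.2.@[fcoord x] = den.@[fcoord x] ^+ mf.1 * (f j).@[x 0].
  apply: (@fin_all_exists 'I_r (fun _ => nat * {mpoly K[nfree]})%type Q) => j.
  by have [M [F FE]] := clear_den (f j); exists (M, F).
have [n [v [[a0 va0] dep]]] :=
  poly_dependence (fun j => (MF j).2) (fun j => den ^+ (MF j).1) r_gt.
pose mon (a : {ffun 'I_r -> 'I_n}) : 'X_{1..r} := [multinom (a j : nat) | j < r].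
pose P : {mpoly K[r]} := \sum_a v a *: 'X_[mon a].
have Pf x : (subst_mpoly f P).@[x 0] = \sum_a v a * \prod_j (f j).@[x 0] ^+ a j.
  rewrite /P (raddf_sum (mmap (@mpolyC N K) f)) (raddf_sum (meval (x 0))) /=; apply: eq_bigr => a _.
  rewrite mmapZ mevalM mevalC mmapX /mmap1 rmorph_prod /=; congr (_ * _).
  by apply: eq_bigr => j _; rewrite rmorphXn /= mnmE.
have : P = 0.
  apply: indf; apply: torus_dense => x Xx x0; have d0 := den_torus x0.
  pose D := \prod_(j < r) den.@[fcoord x] ^+ ((MF j).1 * n).
  have D0 : D != 0 by apply/prodf_neq0 => j _; rewrite expf_neq0.
  apply: (mulfI D0); rewrite mulr0 Pf mulr_sumr.
  have /(congr1 (meval (fcoord x))) := dep; rewrite meval0 => dep0.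
  rewrite -[RHS]dep0 raddf_sum; apply: eq_bigr => a _; rewrite /= mevalZ mulrCA; congr (_ * _).
  rewrite rmorph_prod -big_split; apply: eq_bigr => j _ /=.
  rewrite mevalM !rmorphXn /= MFE // exprMn mulrAC; congr (_ * _).
  by rewrite -!exprM -exprD -mulnDr subnKC // ltnW.
move/(congr1 (mcoeff (mon a0))); rewrite mcoeff0 raddf_sum /= (bigD1 a0) //= big1.
  by rewrite mcoeffZ mcoeffX eqxx mulr1 addr0 => /eqP; rewrite (negbTE va0).
move=> a aa0; rewrite mcoeffZ mcoeffX; case: eqP => [/mnmP maE|_]; last by rewrite mulr0.
case/eqP: aa0; apply/ffunP => j; apply/val_inj.
by have := maE j; rewrite !mnmE.
Qed.

Lemma irr_chain_bound d C : irr_chain X d C -> (d <= nfree)%N.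
Proof.
move=> CX; have [f fC] := chain_alg_indep CX; apply: (@alg_indep_bound _ f) => P PX.
have [/(_ d (leqnn _))[_ sub] _] := CX.
by apply: fC => x /sub; apply: PX.
Qed.

(** * Tangent spaces at the points that are not good *)

Lemma tangent_line x q : (forall i, bmon i x = 0) -> cofac q x = 0 ->
  tangent X x (delta_mx 0 q).
Proof.
(* Only [T_q] varies; another coordinate of its block is zero, so all block monomials stay zero
   along this line. *)
move=> tx cx; pose g p : {poly K} := (x 0 p)%:P + (p == q)%:R *: 'X.
have gq s p : p != q -> (g p).[s] = x 0 p.
  by move=> /negbTE pq; rewrite /g pq scale0r addr0 hornerC.
have g0 : at_time g 0 = x.
  by apply/rowP => p; rewrite mxE hornerD hornerZ hornerC hornerX mulr0 addr0.
have -> : delta_mx 0 q = velocity g 0.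
  by apply/rowP => p; rewrite !mxE eqxx derivD derivC add0r derivZ derivX hornerZ hornerC mulr1.
rewrite -g0; apply: tangent_velocity => s.
have t0 i : bmon i (at_time g s) = 0.
  have [->|iq] := eqVneq i (blk q).
    rewrite bmon_split (_ : cofac q _ = 0) ?mulr0 // -[RHS]cx.
    by apply: eq_bigr => p /andP[_ pq]; rewrite mxE gq.
  rewrite -[RHS](tx i); apply: eq_bigr => p /eqP bp; rewrite mxE gq //.
  by apply: contraNneq iq => <-; rewrite bp.
by move=> i; rewrite !t0 !mulr0 addr0.
Qed.

Lemma root_of_unity n : (1 < n)%N -> exists z : K, z != 1 /\ z ^+ n = 1.
Proof.
(* A root of [1 + z + ... + z^(n-1)] differs from 1 because [n] is nonzero in [K]. *)
move=> n1; have /closed_rootP[z] : size (\poly_(i < n) (1 : K)) != 1%N.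
  by rewrite size_poly_eq ?oner_neq0 // gtn_eqF.
rewrite rootE horner_poly => /eqP z0; exists z; split.
  apply: contra_eq_neq z0 => ->; rewrite (eq_bigr (fun _ => 1)) => [|i _].
    by rewrite sumr_const card_ord natr_neq0 // ltnW.
  by rewrite expr1n mulr1.
apply/eqP; rewrite -subr_eq0 subrX1; rewrite mulf_eq0; apply/orP; right.
by rewrite -[X in _ == X]z0; apply/eqP/eq_bigr => i _; rewrite mul1r.
Qed.

Definition scale_coord (z : K) q : N.-tuple {mpoly K[N]} :=
  [tuple (if p == q then z *: 'X_p else 'X_p) | p < N].

Lemma scale_coord_diff z q f : exists g, comp_mpoly (scale_coord z q) f - f = 'X_q * g /\
  forall x, x 0 q = 0 -> g.@[x 0] = (z - 1) * (f^`M(q)).@[x 0].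
Proof.
elim/mpoly_ring_ind: f => [b|i|f h [g [fg gE]] [g' [hg g'E]]|f h [g [fg gE]] [g' [hg g'E]]].
- exists 0; split=> [|x _]; first by rewrite comp_mpolyC subrr mulr0.
  by rewrite mderivC !meval0 mulr0.
- exists ((i == q)%:R *: (z - 1)%:MP); split=> [|x _].
    rewrite comp_mpolyXU -tnth_nth tnth_mktuple; case: eqP => [->|_].
      by rewrite scale1r mpolyCB mulrBr mulr1 mulrC mul_mpolyC.
    by rewrite subrr scale0r mulr0.
  rewrite mderivXU mevalZ mevalC mulrC; congr (_ * _).
  by case: (i == q); rewrite ?meval1 ?meval0.
- exists (g + g'); split=> [|x xq]; last by rewrite mderivD !mevalD gE // g'E // mulrDr.
  by rewrite comp_mpolyD mulrDr -fg -hg opprD addrACA.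
- exists (g * comp_mpoly (scale_coord z q) h + f * g'); split=> [|x xq].
    by rewrite rmorphM /= mulrDr mulrA -fg mulrCA -hg; ring.
  have hx : (comp_mpoly (scale_coord z q) h).@[x 0] = h.@[x 0].
    by apply/eqP; rewrite -subr_eq0 -mevalB hg mevalM mevalXU xq mul0r.
  by rewrite mderivM !mevalD !mevalM gE // g'E // hx; ring.
Qed.

(* If f vanishes on X then so does f(.., z T_q, ..) - f = T_q g, where z is a root of
   unity of order L q; hence g vanishes on X, and g(x) = (z - 1) (df/dT_q)(x). *)
Lemma tangent_ramified x q : X x -> x 0 q = 0 -> (1 < L q)%N ->
  tangent X x (delta_mx 0 q).
Proof.
move=> Xx xq Lq f f0; have [z [z1 zL]] := root_of_unity Lq.
have [g [fg gE]] := scale_coord_diff z q f.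
rewrite (bigD1 q) //= big1 => [|p pq]; last by rewrite mxE (negbTE pq) andbF mulr0.
rewrite mxE !eqxx mulr1 addr0.
have /vanish_prod[Xq|g0] y : X y -> ('X_q : {mpoly K[N]}).@[y 0] * g.@[y 0] = 0.
- move=> Xy; rewrite -mevalM -fg mevalB meval_comp (f0 y Xy) subr0.
  pose y' : 'rV[K]_N := \row_p (if p == q then z * y 0 p else y 0 p).
  have ty i : bmon i y' = bmon i y.
    apply: eq_bigr => p _; rewrite mxE; case: eqP => [->|//].
    by rewrite exprMn zL mul1r.
  rewrite -[RHS](f0 y') => [|i]; last by rewrite !ty Xy.
  apply: meval_eq => p; rewrite tnth_mktuple mxE.
  by case: eqP; rewrite ?mevalZ mevalXU.
- have [y [Xy y0]] := torus_point; have := Xq y Xy.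
  by rewrite mevalXU => /eqP; rewrite (negbTE (y0 q)).
have := gE x xq; rewrite g0 // => /eqP; rewrite eq_sym mulf_eq0 subr_eq0 (negbTE z1).
by move/eqP.
Qed.

(** If the block of [q] has another zero, the line in direction [q] lies in [X]. Otherwise [q] is
    its only zero, and a vanishing partial derivative forces [L q > 1]. *)
Lemma tangent_coord x q : X x -> (forall i, bmon i x = 0) ->
  ~~ ((x 0 q == 0) && (dmon q x != 0)) -> tangent X x (delta_mx 0 q).
Proof.
move=> Xx tx; have [cq _|cq] := eqVneq (cofac q x) 0; first exact: tangent_line.
have : bmon (blk q) x == 0 by apply/eqP.
rewrite bmon_split mulf_eq0 (negbTE cq) orbF expf_eq0 L_gt0 /= => xq.
rewrite xq negbK => /eqP dq; apply: tangent_ramified => //; first exact/eqP.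
rewrite ltnNge; apply: contraTN isT => Lq1.
have L1 : L q = 1%N by apply/eqP; rewrite eqn_leq Lq1 L_gt0.
by move/eqP: dq; rewrite /block_partial L1 expr0 !mul1r (negbTE cq).
Qed.

(** A point that is not good has at least three blocks without simple zero. Simple zeros lie in
    distinct blocks, so [#|E| <= #|I| - 3], and all other coordinate vectors are tangent. With
    [nfree_bound] this gives [dim U >= N - #|E| > nfree]. *)
Lemma singular_dim x (U : {vspace 'rV[K]_N}) : X x -> ~ good x ->
  (forall v, v \in U <-> tangent X x v) -> (nfree < \dim U)%N.
Proof.
move=> Xx ngx UT; have tx i : bmon i x = 0.
  by apply/eqP/negPn/negP => ti; apply: ngx; left; exists i.
pose E := [set q | (x 0 q == 0) && (dmon q x != 0)].
have E_simple q : q \in E -> simple_block (blk q) x.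
  by rewrite inE => /andP[/eqP xq dq]; exists q.
have ns i0 i1 : i1 != i0 -> exists k, [/\ k != i0, k != i1 & ~ simple_block k x].
  move=> i10; apply: NNPP => H; apply: ngx; right; exists i0, i1; split=> // k k0 k1.
  by apply: NNPP => nk; apply: H; exists k.
have e10 : e1 != e0 by rewrite eq_sym e0_neq_e1.
have [k1 [_ _ s1]] := ns e0 e1 e10.
have [k2 [k21 s2]] : exists k2, k2 != k1 /\ ~ simple_block k2 x.
  have [k10|k10] := eqVneq k1 e0.
    by have [|k [nk _ sk]] := ns k1 e1; [rewrite k10 | exists k].
  by have [|k [nk _ sk]] := ns k1 e0; [rewrite eq_sym | exists k].
have [k3 [k31 k32 s3]] := ns k1 k2 k21.
have blkE_inj : {in E &, injective blk}.
  move=> p q; rewrite !inE => /andP[/eqP xp dp] /andP[/eqP xq _] bpq.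
  apply: contraTeq isT => pq; have [_] := simple_zero xp dp.
  move=> /prodf_neq0/(_ q); rewrite bpq eqxx eq_sym pq => /(_ isT).
  by rewrite xq expf_eq0 L_gt0 eqxx.
have E_small : (#|E| + 3 <= #|I|)%N.
  rewrite -(card_in_imset blkE_inj) -(cardsC (blk @: E)) leq_add2l.
  apply: (@leq_trans #|[set k1; k2; k3]|).
    by rewrite setUC cardsU1 cards2 !inE negb_or k31 k32 eq_sym k21.
  apply/subset_leq_card/subsetP => k; rewrite !inE => kk.
  apply/negP => /imsetP[q /E_simple sq kq]; move: sq; rewrite -kq.
  by case/orP: kk => [/orP[/eqP->|/eqP->]|/eqP->].
pose W := <<[seq (delta_mx 0%R q : 'rV[K]_N) | q <- enum E]>>%VS.
have fullUW : (fullv <= U + W)%VS.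
  apply/subvP => v _; rewrite (row_sum_delta v); apply: memv_suml => q _.
  apply: memvZ; have [qE|qE] := boolP (q \in E).
    apply: (subvP (addvSr U W)); apply: memv_span; apply/mapP.
    by exists q; rewrite ?mem_enum.
  apply: (subvP (addvSl U W)); apply/UT; apply: tangent_coord => //.
  by move: qE; rewrite inE.
have dimN : (N <= \dim U + #|E|)%N.
  have := dimvS fullUW; rewrite dimvf /dim /= mul1n => /leq_trans; apply.
  apply: leq_trans (dimv_add_leqif U W).1 _; rewrite leq_add2l.
  by apply: leq_trans (dim_span _) _; rewrite size_map -cardE.
rewrite -(leq_add2r (#|I| - 2)) addSn; apply: leq_ltn_trans nfree_bound _.
apply: leq_ltn_trans dimN _; rewrite ltn_add2l.
by rewrite ltn_subRL addnC -addnS.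
Qed.

Lemma regular_good x : regular_point X x -> good x.
Proof.
case=> Xx [d [U [[[C CX] _] UT dU]]]; apply: NNPP => ngx.
have := irr_chain_bound CX; rewrite -dU leqNgt.
by rewrite (singular_dim Xx ngx UT).
Qed.

Lemma flexible_pencil : flexible X.
Proof.
split; first by split; [apply: zclosed_pencil | apply: irreducible_pencil].
move=> x regx v; have [Xx [d [U [_ UT _]]]] := regx; split=> [Tv|[s [sX sv]]].
  have [s [sX sP]] := spanned_good Xx (regular_good regx).
  by exists s; split=> //; apply: sP.
apply/UT; apply: (subvP _ _ sv); apply/span_subvP => w /mapP[P /sX PX ->].
by apply/UT; apply: tangent_orbit.
Qed.

End Pencil.

(** * Trinomial varieties *)

Section TrinomialPencil.

Variables (K : closedFieldType) (k : nat) (n : 'I_k.+1 -> nat).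
Variables (lambda : 'I_k.+1 -> K) (l : forall i : 'I_k.+1, 'I_(n i) -> nat).
Hypothesis k_gt0 : (0 < k)%N.

Definition tri_block (p : 'I_(tri_nvars n)) : 'I_k.+1 := tag (enum_val p).
Definition tri_exponent (p : 'I_(tri_nvars n)) : nat := l (tagged (enum_val p)).
Definition tri_al (i : 'I_k.+1) : K :=
  if i == ord0 then 1 else if i == inord 1 then 0 else lambda i.
Definition tri_ga (i : 'I_k.+1) : K := (i != ord0)%:R.

Lemma tri_block_index i (j : 'I_(n i)) : tri_block (tri_index j) = i.
Proof. by rewrite /tri_block /tri_index enum_rankK. Qed.

Lemma tri_exponent_index i (j : 'I_(n i)) : tri_exponent (tri_index j) = l j.
Proof. by rewrite /tri_exponent /tri_index enum_rankK. Qed.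

Lemma tri_index_surj p : exists i (j : 'I_(n i)), p = tri_index j.
Proof.
exists (tag (enum_val p)), (tagged (enum_val p)); rewrite /tri_index.
by rewrite -[LHS]enum_valK; congr enum_rank; case: (enum_val p).
Qed.

Lemma meval_tri_monomial i (x : 'rV[K]_(tri_nvars n)) :
  (tri_monomial K l i).@[x 0] = block_mon tri_block tri_exponent i x.
Proof.
rewrite rmorph_prod /block_mon [RHS](reindex (@enum_rank {i : 'I_k.+1 & 'I_(n i)})) /=; last first.
  exact/onW_bij/enum_rank_bij.
under [RHS]eq_bigl => w do rewrite /tri_block enum_rankK.
under eq_bigr => j _ do rewrite rmorphXn /= mevalXU.
under [RHS]eq_bigr => w _ do rewrite /tri_exponent enum_rankK.
pose F i (j : 'I_(n i)) : K := x 0 (tri_index j) ^+ l j.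
rewrite (eq_bigr (fun w => F (tag w) (tagged w))) => [|[i' j] _ //].
rewrite (eq_bigl (fun w : {i : 'I_k.+1 & 'I_(n i)} => (tag w == i) && true)) => [|w]; last by rewrite andbT.
by rewrite -(sig_big_dep (fun i' => i' == i) (fun _ _ => true) F) big_pred1_eq.
Qed.

Lemma ord1_neq0 : (inord 1 : 'I_k.+1) != ord0.
Proof. by rewrite -val_eqE /= inordK. Qed.

Lemma ge2E (i : 'I_k.+1) : (2 <= i)%N = (i != ord0) && (i != inord 1).
Proof. by rewrite -!val_eqE /= inordK //; case: (val i) => [|[|]]. Qed.

Lemma trinomial_varietyE : trinomial_variety lambda l =
  pencil tri_block tri_exponent tri_al tri_ga ord0 (inord 1).
Proof.
apply: functional_extensionality => x; apply: propositional_extensionality.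
have E i : (trinomial lambda l i).@[x 0] = 0 <->
    block_mon tri_block tri_exponent i x =
    lambda i * block_mon tri_block tri_exponent ord0 x +
    block_mon tri_block tri_exponent (inord 1) x.
  rewrite mevalB mevalD mevalZ !meval_tri_monomial; split=> [/eqP|->].
    by rewrite subr_eq0 => /eqP.
  exact: subrr.
split=> [Xx i|Xx i]; rewrite /tri_al /tri_ga.
  have [->|i0] := eqVneq i ord0; first by rewrite mul1r mul0r addr0.
  have [->|i1] := eqVneq i (inord 1); first by rewrite mul1r mul0r add0r.
  by rewrite mul1r; apply/E/Xx; rewrite ge2E i0.
rewrite ge2E => /andP[i0 i1]; apply/E; have := Xx i.
by rewrite /tri_al /tri_ga (negbTE i0) (negbTE i1) mul1r.
Qed.

End TrinomialPencil.

Theorem theorem2p6 (K : closedFieldType) (charK0 : [pchar K] =i pred0)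
    (k : nat) (k_ge3 : (3 <= k)%N)
    (lambda : 'I_k.+1 -> K)
    (lambda_neq0 : forall i : 'I_k.+1, (2 <= i)%N -> lambda i <> 0)
    (lambda_inj : forall i j : 'I_k.+1,
       (2 <= i)%N -> (2 <= j)%N -> i <> j -> lambda i <> lambda j)
    (n : 'I_k.+1 -> nat)
    (n_gt0 : forall i : 'I_k.+1, (1 <= i)%N -> (1 <= n i)%N)
    (l : forall i : 'I_k.+1, 'I_(n i) -> nat)
    (l_gt0 : forall (i : 'I_k.+1) (j : 'I_(n i)), (1 <= l i j)%N) :
  type_V1 l \/ type_V3 l \/ type_V4 l ->
  flexible (trinomial_variety lambda l).
Proof.
have k_gt0 : (0 < k)%N by apply: leq_trans k_ge3.
move=> type_l; rewrite trinomial_varietyE //.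
have n_gt0' (i : 'I_k.+1) : i != ord0 -> (0 < n i)%N.
  by move=> i0; apply: n_gt0; rewrite lt0n.
have e10 := ord1_neq0 k_gt0.
pose first_var (i : 'I_k.+1) p := exists2 j : 'I_(n i), val j = 0%N & p = tri_index j.
have firstP i : (0 < n i)%N -> exists p, first_var i p.
  by move=> ni; exists (tri_index (Ordinal ni)), (Ordinal ni).
(* Block 0 may be empty, so there [c] takes a default value, the first variable of block 1. *)
have [c cP] : exists c : 'I_k.+1 -> 'I_(tri_nvars n), forall i, i != ord0 -> first_var i (c i).
  pose Q i p := i != ord0 -> first_var i p.
  apply: (@fin_all_exists _ (fun _ => 'I_(tri_nvars n)) Q) => i.
  have [i0|i0] := eqVneq i ord0; last first.
    by have [p] := firstP i (n_gt0' i i0); exists p.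
  by have [p _] := firstP _ (n_gt0' _ e10); exists p; rewrite /Q i0 eqxx.
have L1 i p : first_var i p -> i != ord0 -> i != inord 1 -> tri_exponent l p = 1%N.
  case=> j j0 -> i0 i1; rewrite tri_exponent_index.
  have i2 : (2 <= i)%N by rewrite ge2E // i0.
  case: type_l => [V1|[[_ V3]|[_ _ _ V4]]]; [exact: V1 | | exact: V4].
  by apply: V3 => //; rewrite neq_ltn i2 orbT.
apply: (@flexible_pencil _ _ _ _ _ _ _ _ _ c) => //.
- by rewrite /tri_al (negbTE e10) eqxx.
- by rewrite /tri_ga e10.
- move=> i j ij; rewrite /tri_al /tri_ga.
  have [i0|i0] := eqVneq i ord0.
    by have [j0|j0] := eqVneq j ord0; [rewrite i0 j0 eqxx in ij | rewrite mulr1 mulr0 subr0 oner_neq0].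
  have [j0|j0] := eqVneq j ord0; first by rewrite mulr0 sub0r mulr1 oppr_eq0 oner_neq0.
  rewrite !mulr1 subr_eq0.
  have [i1|i1] := eqVneq i (inord 1); have [j1|j1] := eqVneq j (inord 1).
  + by rewrite i1 j1 eqxx in ij.
  + by rewrite eq_sym; apply/eqP/lambda_neq0; rewrite ge2E // j0.
  + by apply/eqP/lambda_neq0; rewrite ge2E // i0.
  + by apply/eqP/lambda_inj; rewrite ?ge2E ?i0 ?j0 //; apply/eqP.
- by move=> p; have [i [j ->]] := tri_index_surj p; rewrite tri_exponent_index.
- by move=> i /cP[j _ ->]; rewrite tri_block_index.
- by move=> i i0 i1; apply: (L1 i) => //; apply: cP.
case: type_l => [V1|[[n0 V3]|[n0 V4a V4b V4c]]].
- constructor 1 => p; have [i [j ->]] := tri_index_surj p.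
  rewrite tri_block_index tri_exponent_index => i0 i1.
  by apply: V1; rewrite ge2E // i0.
- constructor 2; exists (tri_index (Ordinal n0)); first exact: tri_block_index.
  by rewrite tri_exponent_index V3.
- have n1 := n_gt0' _ e10.
  constructor 3; exists (tri_index (Ordinal n0)), (tri_index (Ordinal n1)); split.
  + exact: tri_block_index.
  + exact: tri_block_index.
  + by rewrite tri_exponent_index V4a.
  + by rewrite tri_exponent_index V4a // inordK.
  + move=> p; have [i [j ->]] := tri_index_surj p.
    rewrite tri_block_index tri_exponent_index => ij; apply: V4b.
    by rewrite leqNgt ge2E // negb_and !negbK.
Qed.
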